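(* Let $L$ be a distributive algebraic lattice with only countably many compact elements. Then $L$ is isomorphic to the lattice of closed ideals of some AF C*-algebra $A$. If, in addition, the greatest element of $L$ is compact, then $A$ can be chosen to be unital.
   Context: An element $a$ of a lattice $L$ is compact if for every subset $X\subseteq L$ such that $\bigvee X$ exists and $a\le\bigvee X$, there is a finite $Y\subseteq X$ with $a\le\bigvee Y$. A lattice is algebraic if it is complete and every element is a supremum of compact elements. All C*-algebras are complex and not necessarily unital. A C*-algebra is AF if it is isomorphic to a direct limit, in the category of C*-algebras and *-homomorphisms (not necessarily unital), of a countable sequence of finite-dimensional C*-algebras and *-homomorphisms. The lattice of closed ideals of $A$ is the set of norm-closed two-sided ideals ordered by inclusion. *)

(* Defs.v *)
From HB Require Import structures.
From mathcomp Require Import all_boot all_order all_algebra.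
From mathcomp Require Import complex.
From mathcomp Require Import all_classical all_reals all_analysis.

Set Implicit Arguments.
Unset Strict Implicit.
Unset Printing Implicit Defensive.

Import Order.TTheory GRing.Theory Num.Theory.
Import numFieldNormedType.Exports.

Local Open Scope classical_set_scope.
Local Open Scope ring_scope.

Definition complete_lattice (d : Order.disp_t) (L : latticeType d) : Prop :=
  forall X : set L, supremums X !=set0 /\ infimums X !=set0.

(* A finite join is rendered as a supremum, so that Y = set0 is meaningful
   without presupposing a bottom element. *)
Definition compact_element (d : Order.disp_t) (L : latticeType d) (a : L) :
    Prop :=
  forall (X : set L) (s : L), supremums X s -> (a <= s)%O ->
  exists Y : set L, [/\ finite_set Y, Y `<=` X &
    exists2 t : L, supremums Y t & (a <= t)%O].

Definition algebraic_lattice (d : Order.disp_t) (L : latticeType d) : Prop :=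
  complete_lattice L /\
  forall a : L, exists2 X : set L,
    X `<=` [set c | compact_element c] & supremums X a.

(* There is no non-unital ring structure in the library, so the product of a
   C*-algebra is an operation of its own.  The norm takes its values in the
   (nonnegative reals of the) scalar field R[i]. *)
HB.mixin Record CompleteNormedModule_isCStarAlgebra (R : realType) A
    of CompleteNormedModule R[i] A := {
  cmul : A -> A -> A ;
  cstar : A -> A ;
  cmulA : associative cmul ;
  cmulDl : left_distributive cmul +%R ;
  cmulDr : right_distributive cmul +%R ;
  cscaleAl : forall (k : R[i]) (x y : A), k *: cmul x y = cmul (k *: x) y ;
  cscaleAr : forall (k : R[i]) (x y : A), k *: cmul x y = cmul x (k *: y) ;
  ler_norm_cmul : forall x y : A, `|cmul x y| <= `|x| * `|y| ;
  cstarK : involutive cstar ;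
  cstarD : {morph cstar : x y / x + y} ;
  cstarZ : forall (k : R[i]) (x : A),
    cstar (k *: x) = Num.conj k *: cstar x ;
  cstarM : forall x y : A, cstar (cmul x y) = cmul (cstar y) (cstar x) ;
  norm_cstar_mul : forall x : A, `|cmul (cstar x) x| = `|x| ^+ 2
}.

#[short(type="cstarAlgType")]
HB.structure Definition CStarAlgebra (R : realType) :=
  {A of CompleteNormedModule_isCStarAlgebra R A & CompleteNormedModule R[i] A}.

Section CStarAlgebras.
Variable R : realType.
Implicit Types A B : cstarAlgType R.

(* The zero algebra counts as unital, with unit 0. *)
Definition unital A : Prop :=
  exists e : A, forall x : A, cmul e x = x /\ cmul x e = x.

Definition finite_dimensional A : Prop :=
  exists n : nat, inhabited (Vector.axiom n A).

Definition is_star_hom A B (f : A -> B) : Prop :=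
  [/\ linear f, {morph f : x y / cmul x y} & {morph f : x / cstar x}].

Definition star_isomorphic A B : Prop :=
  exists2 f : A -> B, is_star_hom f & bijective f.

Definition is_cocone (D : nat -> cstarAlgType R)
    (f : forall n, D n -> D n.+1) B (psi : forall n, D n -> B) : Prop :=
  (forall n, is_star_hom (psi n)) /\
  (forall n (x : D n), psi n.+1 (f n x) = psi n x).

(* The universal property of the colimit in the category of all C*-algebras
   and (not necessarily unital) *-homomorphisms. *)
Definition is_direct_limit (D : nat -> cstarAlgType R)
    (f : forall n, D n -> D n.+1) B (phi : forall n, D n -> B) : Prop :=
  is_cocone f phi /\
  forall (C : cstarAlgType R) (psi : forall n, D n -> C), is_cocone f psi ->
    exists! theta : B -> C,
      is_star_hom theta /\ forall n (x : D n), theta (phi n x) = psi n x.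

Definition is_AF A : Prop :=
  exists (D : nat -> cstarAlgType R) (f : forall n, D n -> D n.+1)
    (B : cstarAlgType R) (phi : forall n, D n -> B),
    [/\ forall n, finite_dimensional (D n),
        forall n, is_star_hom (f n),
        is_direct_limit f phi
      & star_isomorphic A B].

Definition is_closed_ideal A (I : set A) : Prop :=
  [/\ closed I,
      I 0,
      forall (k : R[i]) (x y : A), I x -> I y -> I (k *: x + y)
    & forall a x : A, I x -> I (cmul a x) /\ I (cmul x a)].

Definition closed_ideal A : Type := {I : set A | is_closed_ideal I}.

(* A lattice isomorphism is the same thing as an order isomorphism; closed
   ideals are ordered by inclusion. *)
Definition isomorphic_to_closed_ideals (d : Order.disp_t) (L : latticeType d)
    A : Prop :=
  exists2 F : L -> closed_ideal A, bijective F &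
    forall a b : L, (a <= b)%O <-> sval (F a) `<=` sval (F b).

End CStarAlgebras.

(* Main.v *)
(* The algebra is the limit of a Bratteli diagram whose vertices are labelled by
   nonzero compact elements of L, every label being the join of the labels of
   the successors; l in L corresponds to the closed ideal generated by the blocks
   whose labels lie below l.  For this to give all closed ideals, a vertex v
   must lie in the ideal generated by a set U of vertices of its level as soon
   as its label is below the join of the labels of U.  One step of the diagram
   achieves this: the next vertices are sets F of vertices (the successors of
   their elements) that are prime, i.e. F meets U whenever it contains some v
   with label below the join of U.  By distributivity the label of v is the join,
   over the prime sets F containing v, of the meets of the labels over F, and by
   compactness these meets may be replaced by compact elements below them.  The
   n-th compact element is added as a new vertex at step n; if the first one is
   the top, every later vertex has an old predecessor, so that the connecting
   maps are unital.

   Homomorphisms between C*-algebras are contractive for an elementary reason: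
   a self-adjoint h of norm at most 1/2 is the imaginary part of q = 1 - u, with
   u unitary in the unitization; then q^* q = q^* + q, which bounds the image of
   q, hence that of h, by 2, and the C*-identity improves any such bound to the
   sharp one.  A closed ideal I is generated by the blocks it contains: if a in I
   is close to a matrix d, then compressing a to a matrix unit of a block where d
   is large gives an element of I at distance less than 1 from a projection, and
   this forces the projection into I. *)
From HB Require Import structures.
From mathcomp Require Import all_boot all_order all_algebra.
From mathcomp Require Import complex.
From mathcomp Require Import all_classical all_reals all_analysis.
From mathcomp Require Import ring lra.
Require Import Defs.

Set Implicit Arguments.
Unset Strict Implicit.
Unset Printing Implicit Defensive.

Import Order.TTheory GRing.Theory Num.Theory.
Import numFieldNormedType.Exports.

Local Open Scope classical_set_scope.
Local Open Scope ring_scope.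

(** * Real-valued norms *)

Section ModulusOfComplexNumbers.
Variable R : realType.
Implicit Types (z w : R[i]).

Lemma real_complexD (a b : R) : (a + b)%:C%C = a%:C%C + b%:C%C :> R[i].
Proof. exact: rmorphD. Qed.

Lemma real_complexM (a b : R) : (a * b)%:C%C = a%:C%C * b%:C%C :> R[i].
Proof. exact: rmorphM. Qed.

Lemma real_complexX (a : R) n : (a ^+ n)%:C%C = a%:C%C ^+ n :> R[i].
Proof. exact: rmorphXn. Qed.

Definition cabs z : R := complex.Re `|z|.

Lemma cabsE z : `|z| = (cabs z)%:C%C.
Proof. by rewrite /cabs RRe_real // normr_real. Qed.

Lemma cabs_ge0 z : 0 <= cabs z.
Proof. by rewrite -lecR -cabsE normr_ge0. Qed.

Lemma cabsM z w : cabs (z * w) = cabs z * cabs w.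
Proof. by apply: complexI; rewrite real_complexM -!cabsE normrM. Qed.

Lemma cabsD z w : cabs (z + w) <= cabs z + cabs w.
Proof. by rewrite -lecR real_complexD -!cabsE ler_normD. Qed.

Lemma cabs0 : cabs 0 = 0.
Proof. by apply: complexI; rewrite -cabsE normr0. Qed.

Lemma cabs1 : cabs 1 = 1.
Proof. by apply: complexI; rewrite -cabsE normr1. Qed.

Lemma cabsN z : cabs (- z) = cabs z.
Proof. by rewrite /cabs normrN. Qed.

Lemma cabs_eq0 z : cabs z = 0 -> z = 0.
Proof. by move=> z0; apply/eqP; rewrite -normr_eq0 cabsE z0. Qed.

Lemma cabsR (a : R) : 0 <= a -> cabs a%:C%C = a.
Proof. by move=> a0; rewrite /cabs ger0_norm // ler0c. Qed.

Lemma cabs_conj z : cabs (Num.conj z) = cabs z.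
Proof. by rewrite /cabs norm_conjC. Qed.

Lemma conjC_mul_self z : Num.conj z * z = ((cabs z) ^+ 2)%:C%C.
Proof. by rewrite mulrC -normCK cabsE real_complexX. Qed.

Lemma cabs_Re_le z : `|complex.Re z| <= cabs z.
Proof. by rewrite -lecR -cabsE normc_ge_Re. Qed.

Lemma cabs_Im_le z : `|complex.Im z| <= cabs z.
Proof.
have -> : complex.Im z = complex.Re (- (z * 'i%C)) by case: z => a b /=; ring.
rewrite (le_trans (cabs_Re_le _)) // cabsN cabsM -[leRHS]mulr1.
rewrite ler_wpM2l ?cabs_ge0 // /cabs normc_def /=.
by rewrite expr0n expr1n add0r sqrtr1.
Qed.

Lemma cabs_le_ReIm z : cabs z <= `|complex.Re z| + `|complex.Im z|.
Proof.
have {1}-> : z = (complex.Re z)%:C%C + (complex.Im z)%:C%C * 'i%C.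
  by rewrite {1}[z]complexE [_ * (complex.Im z)%:C%C]mulrC.
rewrite (le_trans (cabsD _ _)) // cabsM.
have -> : cabs 'i%C = 1.
  by rewrite /cabs normc_def /= expr0n expr1n add0r sqrtr1.
have aR (a : R) : cabs a%:C%C = `|a|.
  by rewrite /cabs normc_def /= expr0n addr0 sqrtr_sqr.
by rewrite mulr1 !aR.
Qed.

End ModulusOfComplexNumbers.

(** The norm is a parameter: completeness has to be expressed for a function that is not yet the
    norm of a structure. *)
Definition cauchy_for (R : realType) (V : zmodType) (nm : V -> R)
    (u : nat -> V) : Prop :=
  forall e, 0 < e -> exists N, forall m n, (N <= m)%N -> (N <= n)%N ->
    nm (u m - u n) <= e.

Definition cvg_for (R : realType) (V : zmodType) (nm : V -> R)
    (u : nat -> V) (a : V) : Prop :=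
  forall e, 0 < e -> exists N, forall n, (N <= n)%N -> nm (u n - a) <= e.

(** The norm of a normed module over [R[i]] has values in [R[i]]. This interface starts instead from
    a norm with values in [R], and from completeness for sequences. *)
HB.factory Record Lmodule_isRealNormedComplete (R : realType) V
    of GRing.Lmodule R[i] V := {
  rnm : V -> R;
  rnmD : forall x y, rnm (x + y) <= rnm x + rnm y;
  rnmZ : forall (k : R[i]) x, rnm (k *: x) = cabs k * rnm x;
  rnm_eq0 : forall x, rnm x = 0 -> x = 0;
  rnm_complete : forall u, cauchy_for rnm u -> exists a, cvg_for rnm u a
}.

HB.builders Context R V of Lmodule_isRealNormedComplete R V.

Definition cnm (x : V) : R[i] := (rnm x)%:C%C.

Fact cnmD x y : cnm (x + y) <= cnm x + cnm y.
Proof. by rewrite /cnm -real_complexD lecR rnmD. Qed.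

Fact cnmZ (k : R[i]) x : cnm (k *: x) = `|k| * cnm x.
Proof. by rewrite /cnm rnmZ real_complexM cabsE. Qed.

Fact cnm_eq0 x : cnm x = 0 -> x = 0.
Proof. by move=> x0; apply: rnm_eq0; apply: complexI; rewrite -/(cnm x). Qed.

HB.instance Definition _ := Lmodule_isNormed.Build R[i] V cnmD cnmZ cnm_eq0.

(** In a Cauchy filter one picks balls of radius [1/(n+1)] with centres [u n]. Any two of them meet,
    so [u] is a Cauchy sequence, and its limit is the limit of the filter. *)
Fact cnm_complete (F : set_system V) :
  ProperFilter F -> cauchy F -> cvg F.
Proof.
move=> FF /cauchyP Fc.
have e_gt0 n : 0 < (n.+1%:R^-1 : R) by rewrite invr_gt0 ltr0n.
pose P n (x : V) := F (ball x (n.+1%:R^-1 : R)%:C%C).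
have Pex n : exists x, P n x by apply: Fc; rewrite ltcR.
have [u uP] := choice Pex.
have bE (x y : V) e : ball x e%:C%C y -> rnm (x - y) < e.
  by rewrite -ball_normE /= /Num.norm /= /cnm ltcR.
have uB m n : rnm (u m - u n) <= m.+1%:R^-1 + n.+1%:R^-1.
  have [z [/bE zm /bE zn]] := filter_ex (filterI (uP m) (uP n)).
  rewrite -[u m](subrK z) -addrA (le_trans (rnmD _ _)) // lerD ?ltW //.
  by rewrite -opprB -scaleN1r rnmZ cabsN cabs1 mul1r.
have inv_small e : 0 < e -> exists N, forall n, (N <= n)%N -> n.+1%:R^-1 <= e :> R.
  move=> e0; have [N _ NP] := near_infty_natSinv_lt (PosNum e0).
  by exists N => n /NP /ltW.
have [a aP] : exists a, cvg_for rnm u a.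
  apply: rnm_complete => e e0; have [N NP] := inv_small _ (divr_gt0 e0 (ltr0n _ 2)).
  exists N => m n Nm Nn; rewrite (le_trans (uB _ _)) //.
  by rewrite [e]splitr lerD ?NP.
apply/cvg_ex; exists a; apply/cvgrPdist_lt => e e0.
(* A positive element of [R[i]] is real, so the radius may be replaced by its real part. *)
have eE : e = (complex.Re e)%:C%C by rewrite RRe_real // gtr0_real.
have {}e0 : 0 < complex.Re e by rewrite -ltcR -eE.
set d := complex.Re e / 2.
have d0 : 0 < d by rewrite divr_gt0.
have [N NP] := inv_small _ d0; have [M MP] := aP _ d0.
have uM := uP (maxn M N).
apply: filterS uM => x /bE xu.
rewrite /Num.norm /= /cnm eE ltcR [ltRHS]splitr -/d.
rewrite -[a](subrK (u (maxn M N))) -addrA (le_lt_trans (rnmD _ _)) //.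
rewrite ler_ltD ?(lt_le_trans xu) ?NP ?leq_maxr //.
by rewrite -opprB -scaleN1r rnmZ cabsN cabs1 mul1r MP // leq_maxl.
Qed.

HB.instance Definition _ := Uniform_isComplete.Build V cnm_complete.

HB.end.

Section RealNorm.
Variables (R : realType).

Section NormedModule.
Variable V : normedModType R[i].
Implicit Types (x y : V).

Definition rnorm x : R := complex.Re `|x|.

Lemma rnormE x : `|x| = (rnorm x)%:C%C.
Proof. by rewrite /rnorm RRe_real // normr_real. Qed.

Lemma rnorm_ge0 x : 0 <= rnorm x.
Proof. by rewrite -lecR -rnormE normr_ge0. Qed.

Lemma rnormD x y : rnorm (x + y) <= rnorm x + rnorm y.
Proof. by have := ler_normD x y; rewrite !rnormE -real_complexD lecR. Qed.

Lemma rnormB x y : rnorm (x - y) <= rnorm x + rnorm y.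
Proof. by have := ler_normB x y; rewrite !rnormE -real_complexD lecR. Qed.

Lemma rnormN x : rnorm (- x) = rnorm x.
Proof. by rewrite /rnorm normrN. Qed.

Lemma rnorm_distC x y : rnorm (x - y) = rnorm (y - x).
Proof. by rewrite /rnorm distrC. Qed.

Lemma rnorm_dist3 x y z : rnorm (x - z) <= rnorm (x - y) + rnorm (y - z).
Proof. by have := rnormD (x - y) (y - z); rewrite addrA subrK. Qed.

Lemma rnorm_dist_dist x y : `|rnorm x - rnorm y| <= rnorm (x - y).
Proof.
have := rnormD (x - y) y; have := rnormD (y - x) x; rewrite !subrK.
rewrite rnorm_distC ler_norml; lra.
Qed.

Lemma rnormZ (k : R[i]) x : rnorm (k *: x) = cabs k * rnorm x.
Proof. by apply: complexI; rewrite real_complexM -cabsE -!rnormE normrZ. Qed.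

Lemma rnorm0 : rnorm (0 : V) = 0.
Proof. by apply: complexI; rewrite -rnormE normr0. Qed.

Lemma rnorm_eq0 x : rnorm x = 0 -> x = 0.
Proof. by move=> x0; apply/eqP; rewrite -normr_eq0 rnormE x0. Qed.

Lemma rnorm_eq x y : (forall e, 0 < e -> rnorm (x - y) <= e) -> x = y.
Proof.
move=> xy; apply/eqP; rewrite -subr_eq0; apply/eqP/rnorm_eq0/eqP.
by rewrite eq_le rnorm_ge0 andbT; apply/ler_addgt0Pl => e e0; rewrite addr0 xy.
Qed.

Lemma closed_rnormP (I : set V) :
  closed I <->
  forall x, (forall e, 0 < e -> exists2 y, I y & rnorm (x - y) <= e) -> I x.
Proof.
rewrite closure_id; split => [cI x xI|cI].
  rewrite cI => B /nbhs_normP [e /= e0 eB].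
  have eE : e = (complex.Re e)%:C%C by rewrite RRe_real // gtr0_real.
  have {}e0 : 0 < complex.Re e by rewrite -ltcR -eE.
  have [y Iy xy] := xI _ (divr_gt0 e0 (ltr0n _ 2)).
  exists y; split => //; apply: eB; rewrite /= rnormE eE ltcR.
  by rewrite (le_lt_trans xy) // ltr_pdivrMr // ltr_pMr // ltr1n.
apply/seteqP; split; first exact: subset_closure.
move=> x xI; apply: cI => e e0.
have /xI [y [Iy /= yx]] : nbhs x (ball x e%:C%C) by apply: nbhsx_ballx; rewrite ltcR.
exists y => //; move: yx; rewrite -ball_normE /= rnormE ltcR; exact: ltW.
Qed.

End NormedModule.

Lemma rnorm_complete (V : completeNormedModType R[i]) (u : nat -> V) :
  cauchy_for (@rnorm V) u -> exists a, cvg_for (@rnorm V) u a.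
Proof.
move=> uc.
have : cauchy (u @ \oo).
  apply/cauchyP => e e0.
  have eE : e = (complex.Re e)%:C%C by rewrite RRe_real // gtr0_real.
  have {}e0 : 0 < complex.Re e by rewrite -ltcR -eE.
  have [N NP] := uc _ (divr_gt0 e0 (ltr0n _ 2)).
  exists (u N); exists N => // n /= Nn.
  rewrite -ball_normE /= rnormE eE ltcR (le_lt_trans (NP _ _ _ _)) //.
  by rewrite ltr_pdivrMr // ltr_pMr // ltr1n.
move=> /cauchy_cvg /cvg_ex [a /cvgrPdist_le ua].
exists a => e e0; have /ua [N _ NP] : 0 < e%:C%C by rewrite ltcR.
by exists N => n /NP; rewrite rnormE lecR rnorm_distC.
Qed.

End RealNorm.

(** * C*-algebras and their homomorphisms *)

Lemma bernoulli_le (R : realDomainType) (t : R) n :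
  0 <= t -> 1 + n%:R * t <= (1 + t) ^+ n.
Proof.
move=> t0; elim: n => [|n IHn]; first by rewrite mul0r addr0 expr0.
rewrite exprS; have t1 : 0 <= 1 + t by rewrite addr_ge0.
apply: le_trans (ler_wpM2l t1 IHn).
have := mulr_ge0 (mulr_ge0 (ler0n R n) t0) t0.
rewrite -natr1; lra.
Qed.

(* Used with sq x = x^* x.  Iterating sq n times turns the constant C into its
   2^n-th root. *)
Lemma le_of_square_le (R : realType) (T : Type) (sq : T -> T) (p q : T -> R)
    (C : R) :
  (forall x, 0 <= q x) ->
  (forall x, p (sq x) = p x ^+ 2) -> (forall x, q (sq x) = q x ^+ 2) ->
  (forall x, p x <= C * q x) -> forall x, p x <= q x.
Proof.
move=> q0 psq qsq pCq x; rewrite leNgt; apply/negP => qp.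
have iterE (f : T -> R) n :
    (forall x, f (sq x) = f x ^+ 2) -> f (iter n sq x) = f x ^+ (2 ^ n).
  by move=> fsq; elim: n => [|n IHn] //=; rewrite fsq IHn -exprM expnS mulnC.
have [qx0|qx0] := eqVneq (q x) 0.
  by have := pCq x; rewrite qx0 mulr0 leNgt -{1}qx0 qp.
have qx_gt0 : 0 < q x by rewrite lt_neqAle eq_sym qx0 q0.
set t := p x / q x - 1.
have t0 : 0 < t by rewrite subr_gt0 ltr_pdivlMr // mul1r.
(* After [n] squarings [(1 + t)^(2^n) <= C], and the Bernoulli inequality bounds the left side below
   by [2^n t], hence by [n t]. The Archimedean property then gives the contradiction. *)
have Cn n : n%:R * t <= C.
  have := pCq (iter n sq x); rewrite !iterE // -ler_pdivrMr ?exprn_gt0 //.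
  rewrite -expr_div_n; apply: le_trans.
  have -> : p x / q x = 1 + t by rewrite /t addrC subrK.
  apply: le_trans (bernoulli_le _ (ltW t0)).
  rewrite (@le_trans _ _ ((2 ^ n)%:R * t)) ?lerDr //.
  by rewrite ler_pM2r // ler_nat ltnW // ltn_expl.
have C0 : 0 <= C by have := Cn 0%N; rewrite mul0r.
have := archi_boundP (divr_ge0 C0 (ltW t0)).
by rewrite ltr_pdivrMr // ltNge Cn.
Qed.

(** * Limits of sequences *)

Section Limits.
Variables (R : realType) (V : normedModType R[i]).
Implicit Types (u v : nat -> V) (a b : V).

Lemma cvg_for_unique u a b :
  cvg_for (@rnorm R V) u a -> cvg_for (@rnorm R V) u b -> a = b.
Proof.
move=> ua ub; apply: rnorm_eq => e e0.
have e2 : 0 < e / 2 by rewrite divr_gt0.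
have [N NP] := ua _ e2; have [M MP] := ub _ e2.
rewrite (le_trans (rnorm_dist3 _ (u (maxn N M)) _)) // [e]splitr lerD //.
  by rewrite rnorm_distC NP ?leq_maxl.
by rewrite MP ?leq_maxr.
Qed.

Lemma cvg_for_cst a : cvg_for (@rnorm R V) (fun=> a) a.
Proof. by move=> e /ltW e0; exists 0%N => n _; rewrite subrr rnorm0. Qed.

Lemma cvg_forD u v a b :
  cvg_for (@rnorm R V) u a -> cvg_for (@rnorm R V) v b ->
  cvg_for (@rnorm R V) (fun n => u n + v n) (a + b).
Proof.
move=> ua vb e e0; have e2 : 0 < e / 2 by rewrite divr_gt0.
have [N NP] := ua _ e2; have [M MP] := vb _ e2.
exists (maxn N M) => n; rewrite geq_max => /andP[Nn Mn].
by rewrite opprD addrACA (le_trans (rnormD _ _)) // [e]splitr lerD ?NP ?MP.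
Qed.

Lemma cvg_for_comp (W : normedModType R[i]) (f : V -> W) (C : R) u a :
  (forall x y, rnorm (f x - f y) <= C * rnorm (x - y)) ->
  cvg_for (@rnorm R V) u a -> cvg_for (@rnorm R W) (f \o u) (f a).
Proof.
move=> fC ua e e0; have C1 : 0 < `|C| + 1 by rewrite ltr_wpDl.
have [N NP] := ua _ (divr_gt0 e0 C1); exists N => n /NP.
rewrite ler_pdivlMr // mulrC; apply: le_trans.
rewrite (le_trans (fC _ _)) // ler_wpM2r ?rnorm_ge0 //.
by rewrite (le_trans (ler_norm _)) // lerDl.
Qed.

Lemma cvg_forZ (k : R[i]) u a :
  cvg_for (@rnorm R V) u a -> cvg_for (@rnorm R V) (fun n => k *: u n) (k *: a).
Proof.
by apply: (@cvg_for_comp V _ (cabs k)) => x y; rewrite -scalerBr rnormZ.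
Qed.

Lemma cvg_for_shift k u a :
  cvg_for (@rnorm R V) u a -> cvg_for (@rnorm R V) (fun n => u (n + k)%N) a.
Proof.
move=> ua e /ua[N NP]; exists N => n Nn; apply: NP.
exact: leq_trans Nn (leq_addr _ _).
Qed.

Lemma cvg_for_eventually N u v a :
  (forall n, (N <= n)%N -> u n = v n) ->
  cvg_for (@rnorm R V) u a -> cvg_for (@rnorm R V) v a.
Proof.
move=> uv ua e /ua[M MP]; exists (maxn N M) => n.
by rewrite geq_max => /andP[/uv <- /MP].
Qed.

Lemma cauchy_for_geometric u :
  (forall n, rnorm (u n.+1 - u n) <= 2^-1 ^+ n) -> cauchy_for (@rnorm R V) u.
Proof.
move=> ug.
have ub m k : rnorm (u (k + m)%N - u m) <= 2 * 2^-1 ^+ m * (1 - 2^-1 ^+ k).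
  elim: k => [|k IHk]; first by rewrite add0n subrr rnorm0 expr0 subrr mulr0.
  rewrite addSn (le_trans (rnorm_dist3 _ (u (k + m)%N) _)) //.
  rewrite (le_trans (lerD (ug _) IHk)) // exprD exprS.
  set x := _ ^+ k; set y := _ ^+ m; rewrite le_eqVlt; apply/orP; left.
  by apply/eqP; field.
have ub' m k : rnorm (u (k + m)%N - u m) <= 2 * 2^-1 ^+ m.
  rewrite (le_trans (ub m k)) // ler_piMr ?mulr_ge0 ?exprn_ge0 ?invr_ge0 //.
move=> e e0; have [N NP] : exists N, 4 * 2^-1 ^+ N <= e.
  exists (Num.bound (4 / e)).
  have := archi_boundP (divr_ge0 (ler0n _ 4) (ltW e0)); set N := Num.bound _.
  rewrite ltr_pdivrMr // => /ltW N4.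
  rewrite exprVn ler_pdivrMr ?exprn_gt0 // (le_trans N4) // mulrC.
  by rewrite ler_pM2l // -natrX ler_nat ltnW // ltn_expl.
exists N => m n Nm Nn; apply: le_trans NP.
rewrite (le_trans (rnorm_dist3 _ (u N) _)) //.
have -> : 4 * 2^-1 ^+ N = 2 * 2^-1 ^+ N + 2 * 2^-1 ^+ N :> R by ring.
rewrite lerD //; first by rewrite -(subnK Nm) ub'.
by rewrite rnorm_distC -(subnK Nn) ub'.
Qed.

End Limits.

Section CStarAlgebraTheory.
Variables (R : realType) (A : cstarAlgType R).
Implicit Types (x y z : A).

Lemma cmul0l x : cmul 0 x = 0.
Proof. by apply: (addrI (cmul 0 x)); rewrite -cmulDl !addr0. Qed.

Lemma cmul0r x : cmul x 0 = 0.
Proof. by apply: (addrI (cmul x 0)); rewrite -cmulDr !addr0. Qed.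

Lemma cmulNl x y : cmul (- x) y = - cmul x y.
Proof. by rewrite -scaleN1r -cscaleAl scaleN1r. Qed.

Lemma cmulNr x y : cmul x (- y) = - cmul x y.
Proof. by rewrite -scaleN1r -cscaleAr scaleN1r. Qed.

Lemma cmulBl x y z : cmul (x - y) z = cmul x z - cmul y z.
Proof. by rewrite cmulDl cmulNl. Qed.

Lemma cmulBr x y z : cmul x (y - z) = cmul x y - cmul x z.
Proof. by rewrite cmulDr cmulNr. Qed.

Lemma cstar0 : cstar (0 : A) = 0.
Proof. by apply: (addrI (cstar 0)); rewrite -cstarD !addr0. Qed.

Lemma cstarN x : cstar (- x) = - cstar x.
Proof. by rewrite -scaleN1r cstarZ rmorphN rmorph1 scaleN1r. Qed.

Lemma cstarB x y : cstar (x - y) = cstar x - cstar y.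
Proof. by rewrite cstarD cstarN. Qed.

Lemma rnorm_cmul x y : rnorm (cmul x y) <= rnorm x * rnorm y.
Proof. by have := ler_norm_cmul x y; rewrite !rnormE -real_complexM lecR. Qed.

Lemma rnorm_cstar_mul x : rnorm (cmul (cstar x) x) = rnorm x ^+ 2.
Proof.
by have := norm_cstar_mul x; rewrite !rnormE -real_complexX => /complexI.
Qed.

(** The C*-identity gives [|y|^2 <= |cstar y| |y|]. Division by [|y|] yields one inequality, and
    [y = cstar x] yields the other. *)
Lemma rnorm_cstar x : rnorm (cstar x) = rnorm x.
Proof.
suff le_star y : rnorm y <= rnorm (cstar y).
  by apply/eqP; rewrite eq_le -{2}[x]cstarK !le_star.
have [y0|y0] := eqVneq (rnorm y) 0; first by rewrite y0 rnorm_ge0.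
have y_gt0 : 0 < rnorm y by rewrite lt_neqAle eq_sym y0 rnorm_ge0.
rewrite -(ler_pM2r y_gt0) -expr2 -rnorm_cstar_mul.
exact: rnorm_cmul.
Qed.

Lemma cvg_for_cstar (u : nat -> A) a :
  cvg_for (@rnorm R A) u a -> cvg_for (@rnorm R A) (fun n => cstar (u n)) (cstar a).
Proof.
apply: (@cvg_for_comp R A A (@cstar R A) 1) => x y.
by rewrite -cstarB rnorm_cstar mul1r.
Qed.

Lemma cvg_for_cmul (u v : nat -> A) a b :
  cvg_for (@rnorm R A) u a -> cvg_for (@rnorm R A) v b ->
  cvg_for (@rnorm R A) (fun n => cmul (u n) (v n)) (cmul a b).
Proof.
move=> ua vb e e0.
pose C := rnorm a + 1 + rnorm b.
have C0 : 0 < C by rewrite ltr_wpDr ?rnorm_ge0 // ltr_wpDl ?rnorm_ge0.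
have [N NP] := ua _ (divr_gt0 e0 C0); have [M MP] := vb _ (divr_gt0 e0 C0).
have [N1 NP1] := ua _ ltr01.
exists (maxn N1 (maxn N M)) => n; rewrite !geq_max => /and3P[N1n Nn Mn].
have -> : cmul (u n) (v n) - cmul a b = cmul (u n) (v n - b) + cmul (u n - a) b.
  by rewrite cmulBr cmulBl addrA subrK.
rewrite (le_trans (rnormD _ _)) //.
have un1 : rnorm (u n) <= rnorm a + 1.
  by rewrite -[u n](subrK a) addrC (le_trans (rnormD _ _)) // lerD // NP1.
have eE : e = (rnorm a + 1) * (e / C) + (e / C) * rnorm b.
  by rewrite [X in _ + X]mulrC -mulrDl -/C mulrC divfK // gt_eqF.
rewrite eE lerD // (le_trans (rnorm_cmul _ _)) //.
  by rewrite ler_pM ?rnorm_ge0 // MP.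
by rewrite ler_wpM2r ?rnorm_ge0 // NP.
Qed.

(* The Banach fixed point of y |-> (h^2 + y^2) / 2. *)
Lemma exists_one_minus_sqrt (h : A) : cstar h = h -> rnorm h <= 2^-1 ->
  exists y, [/\ cstar y = y, cmul h y = cmul y h &
    y + y = cmul h h + cmul y y].
Proof.
move=> hs h2; pose next y : A := (2^-1 : R[i]) *: (cmul h h + cmul y y).
pose u n := iter n next 0.
have c2 : cabs (2^-1 : R[i]) = 2^-1.
  have -> : (2^-1 : R[i]) = (2^-1 : R)%:C%C by rewrite fmorphV rmorph_nat.
  by rewrite cabsR ?invr_ge0.
have us n : cstar (u n) = u n.
  elim: n => [|n IHn] /=; first exact: cstar0.
  by rewrite cstarZ cstarD !cstarM IHn hs fmorphV rmorph_nat.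
have uh n : cmul h (u n) = cmul (u n) h.
  elim: n => [|n IHn] /=; first by rewrite cmul0l cmul0r.
  rewrite -cscaleAl -cscaleAr cmulDl cmulDr; congr (_ *: (_ + _)).
    by rewrite cmulA.
  by rewrite cmulA IHn -cmulA IHn cmulA.
have u2 n : rnorm (u n) <= 2^-1.
  elim: n => [|n IHn] /=; first by rewrite rnorm0 invr_ge0.
  rewrite rnormZ c2 ler_piMr ?invr_ge0 // (le_trans (rnormD _ _)) //.
  rewrite (le_trans (lerD (rnorm_cmul _ _) (rnorm_cmul _ _))) //.
  have := ler_pM (rnorm_ge0 _) (rnorm_ge0 _) h2 h2.
  have := ler_pM (rnorm_ge0 _) (rnorm_ge0 _) IHn IHn.
  lra.
(* Since [y^2 - z^2 = y (y - z) + (y - z) z] and the iterates have norm at most 1/2, the factor 1/2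
   in [next] at least halves the differences. *)
have ug n : rnorm (u n.+1 - u n) <= 2^-1 ^+ n.
  elim: n => [|n IHn].
    by rewrite subr0 expr0 (le_trans (u2 1%N)) // invf_le1 // ler1n.
  have -> : u n.+2 - u n.+1 = (2^-1 : R[i]) *:
      (cmul (u n.+1) (u n.+1 - u n) + cmul (u n.+1 - u n) (u n)).
    rewrite cmulBr cmulBl addrA subrK -scalerBr; congr (_ *: _).
    by rewrite opprD addrACA subrr add0r.
  rewrite rnormZ c2 exprS ler_wpM2l ?invr_ge0 // (le_trans (rnormD _ _)) //.
  rewrite (le_trans (lerD (rnorm_cmul _ _) (rnorm_cmul _ _))) //.
  have d0 := rnorm_ge0 (u n.+1 - u n).
  have := ler_wpM2r d0 (u2 n.+1); have := ler_wpM2l d0 (u2 n).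
  lra.
have [y uy] := rnorm_complete (cauchy_for_geometric ug).
exists y; split.
- apply: cvg_for_unique (cvg_for_cstar uy) _.
  by under eq_fun do rewrite us.
- apply: cvg_for_unique (cvg_for_cmul (cvg_for_cst h) uy) _.
  by under eq_fun do rewrite uh; apply: cvg_for_cmul uy (cvg_for_cst h).
- have yE : y = (2^-1 : R[i]) *: (cmul h h + cmul y y).
    apply: cvg_for_unique (cvg_for_shift 1 uy) _.
    under eq_fun do rewrite addn1.
    exact: cvg_forZ (cvg_forD (cvg_for_cst (cmul h h)) (cvg_for_cmul uy uy)).
  have half : 2^-1 + 2^-1 = 1 :> R[i] by rewrite [RHS]splitr mul1r.
  by rewrite {1 2}yE -scalerDl half scale1r.
Qed.

End CStarAlgebraTheory.

(** * Contractivity of homomorphisms *)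

Section StarHom.
Variables (R : realType) (A B : cstarAlgType R) (f : A -> B).
Hypothesis hf : is_star_hom f.

Lemma star_homM x y : f (cmul x y) = cmul (f x) (f y).
Proof. by case: hf => _ ->. Qed.

Lemma star_homS x : f (cstar x) = cstar (f x).
Proof. by case: hf => _ _ ->. Qed.

Lemma star_homP (k : R[i]) x y : f (k *: x + y) = k *: f x + f y.
Proof. by case: hf => ->. Qed.

Lemma star_homD x y : f (x + y) = f x + f y.
Proof. by rewrite -[x]scale1r star_homP !scale1r. Qed.

Lemma star_hom0 : f 0 = 0.
Proof. by apply: (addrI (f 0)); rewrite -star_homD !addr0. Qed.

Lemma star_homZ (k : R[i]) x : f (k *: x) = k *: f x.
Proof. by rewrite -[_ *: x]addr0 star_homP star_hom0 addr0. Qed.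

Lemma star_homN x : f (- x) = - f x.
Proof. by rewrite -scaleN1r star_homZ scaleN1r. Qed.

Lemma star_homB x y : f (x - y) = f x - f y.
Proof. by rewrite star_homD star_homN. Qed.

Lemma star_hom_sum I (r : seq I) (P : pred I) (F : I -> A) :
  f (\sum_(i <- r | P i) F i) = \sum_(i <- r | P i) f (F i).
Proof. exact: (big_morph f star_homD star_hom0). Qed.

(* A self-adjoint h is the imaginary part of q = (1 - sqrt (1 - h^2)) + i h, and
   1 - q is a unitary of the unitization, so that q^* q = q^* + q. *)
Lemma star_hom_selfadjoint_le2 h :
  cstar h = h -> rnorm h <= 2^-1 -> rnorm (f h) <= 2.
Proof.
move=> hs h2; have [y [ys hy yE]] := exists_one_minus_sqrt hs h2.
pose q := y + 'i%C *: h.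
have qsE : cstar q = y - 'i%C *: h.
  by rewrite cstarD cstarZ ys hs -scaleNr !complexiE conjCi.
have qE : cmul (cstar q) q = cstar q + q.
  rewrite qsE /q cmulBl !cmulDr -!cscaleAl -!cscaleAr hy scalerA.
  rewrite -expr2 sqr_i scaleN1r opprD opprK addrA addrK addrC -yE.
  by rewrite addrACA addNr addr0.
set p := f q; have pE : cmul (cstar p) p = cstar p + p.
  by rewrite -star_homS -star_homM qE star_homD.
have p2 : rnorm p <= 2.
  have [p0|p0] := eqVneq (rnorm p) 0; first by rewrite p0.
  have p_gt0 : 0 < rnorm p by rewrite lt_neqAle eq_sym p0 rnorm_ge0.
  rewrite -(ler_pM2r p_gt0) -expr2 -rnorm_cstar_mul pE.
  by rewrite (le_trans (rnormD _ _)) // rnorm_cstar -mulr2n mulr_natl.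
have : rnorm (p - cstar p) <= 4.
  by rewrite (le_trans (rnormB _ _)) // rnorm_cstar; lra.
have -> : p - cstar p = (2 * 'i%C) *: f h.
  rewrite -star_homS -star_homB qsE -star_homZ opprD opprK addrACA subrr add0r.
  by rewrite -scalerDl -mulr2n mulr_natl.
rewrite rnormZ cabsM.
have -> : cabs ('i%C : R[i]) = 1.
  by rewrite /cabs normc_def /= expr0n expr1n add0r sqrtr1.
have -> : cabs (2 : R[i]) = 2.
  have -> : (2 : R[i]) = (2 : R)%:C%C by rewrite rmorph_nat.
  by rewrite cabsR.
lra.
Qed.

(** Rescaling self-adjoint elements to norm 1/2 turns the bound 2 into the factor 4. Applied to
    [cmul (cstar x) x], this is the factor 2 for every [x], and [le_of_square_le] lowers it to 1. *)
Theorem star_hom_contractive x : rnorm (f x) <= rnorm x.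
Proof.
pose sq (C : cstarAlgType R) (z : C) := cmul (cstar z) z.
have sa4 h : cstar h = h -> rnorm (f h) <= 4 * rnorm h.
  move=> hs; have [h0|h0] := eqVneq (rnorm h) 0.
    by rewrite (rnorm_eq0 h0) star_hom0 !rnorm0 mulr0.
  have h_gt0 : 0 < rnorm h by rewrite lt_neqAle eq_sym h0 rnorm_ge0.
  pose c : R := (2 * rnorm h)^-1.
  have c0 : 0 < c by rewrite invr_gt0 mulr_gt0.
  have := @star_hom_selfadjoint_le2 (c%:C%C *: h).
  rewrite cstarZ hs star_homZ !rnormZ cabsR; last exact: ltW.
  have -> : Num.conj (c%:C%C) = c%:C%C :> R[i].
    by apply: conj_Creal; rewrite complex_real.
  have -> : c * rnorm h = 2^-1 by rewrite /c invfM -mulrA mulVf // mulr1.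
  move=> /(_ erefl (lexx _)); rewrite -ler_pdivlMl // /c invrK.
  by rewrite mulrAC -natrM.
apply: (@le_of_square_le R A (@sq A) (fun x => rnorm (f x)) _ 2) => [z|z|z|z].
- exact: rnorm_ge0.
- by rewrite /sq star_homM star_homS rnorm_cstar_mul.
- exact: rnorm_cstar_mul.
- rewrite -ler_sqr ?nnegrE ?mulr_ge0 ?rnorm_ge0 // exprMn -!rnorm_cstar_mul.
  rewrite -star_homS -star_homM.
  have -> : 2 ^+ 2 = 4 :> R by rewrite -natrX.
  by rewrite sa4 // cstarM cstarK.
Qed.

Lemma cvg_for_star_hom (u : nat -> A) a :
  cvg_for (@rnorm R A) u a -> cvg_for (@rnorm R B) (f \o u) (f a).
Proof.
apply: (@cvg_for_comp R A B f 1) => x y.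
by rewrite -star_homB mul1r star_hom_contractive.
Qed.

End StarHom.

(** * Limits of isometric systems *)

Lemma real_cauchy_cvg (R : realType) (u : nat -> R) :
  cauchy_for (fun x : R => `|x|) u -> cvgn u.
Proof.
move=> uc; apply: cauchy_cvg; apply/cauchyP => e e0.
have [N NP] := uc _ (divr_gt0 e0 (ltr0n _ 2)).
exists (u N); exists N => // n /= Nn.
rewrite /ball /= (le_lt_trans (NP _ _ _ _)) //.
by rewrite ltr_pdivrMr // ltr_pMr // ltr1n.
Qed.

Lemma star_hom_id (R : realType) (A : cstarAlgType R) : is_star_hom (@idfun A).
Proof. by split. Qed.

Lemma star_hom_comp (R : realType) (A B C : cstarAlgType R)
    (f : A -> B) (g : B -> C) :
  is_star_hom f -> is_star_hom g -> is_star_hom (g \o f).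
Proof.
move=> [f1 f2 f3] [g1 g2 g3]; split => [k x y|x y|x] /=.
- by rewrite f1 g1.
- by rewrite f2 g2.
- by rewrite f3 g3.
Qed.

Record isometric_system (R : realType) := IsometricSystem {
  sysD : nat -> cstarAlgType R;
  sysf : forall n, sysD n -> sysD n.+1;
  sys_hom : forall n, is_star_hom (@sysf n);
  sys_iso : forall n (x : sysD n), rnorm (sysf x) = rnorm x
}.

Section Threads.
Variables (R : realType) (S : isometric_system R).
Local Notation D := (sysD S).
Local Notation thread := (forall n, D n).
Implicit Types (x y z : thread).

(** The index is [k + n], which computes along the recursion on [k], so that no cast appears. *)
Fixpoint shift n k : D n -> D (k + n)%N :=
  if k is k'.+1 then fun d => sysf (shift k' d) else idfun.

Lemma shift_hom n k : is_star_hom (@shift n k).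
Proof.
elim: k => [|k IHk] /=; first exact: star_hom_id.
by apply: (star_hom_comp IHk); exact: sys_hom.
Qed.

Lemma shift_iso n k (d : D n) : rnorm (shift k d) = rnorm d.
Proof. by elim: k => //= k IHk; rewrite sys_iso. Qed.

(** Threads are compatible only asymptotically. Modulo the negligible ones they already form a
    complete space, and the limit needs no separate completion. As the connecting maps are
    isometric, the norms along such a thread converge. *)
Definition coherent x := forall e : R, 0 < e ->
  \forall n \near \oo, forall k, rnorm (x (k + n)%N - shift k (x n)) <= e.

Definition negligible x := forall e : R, 0 < e ->
  \forall n \near \oo, rnorm (x n) <= e.

Lemma coherent_bounded x : coherent x ->
  exists2 C : R, 0 < C & \forall n \near \oo, rnorm (x n) <= C.
Proof.
move=> /(_ 1 ltr01) [N _ /(_ N (leqnn N)) xN].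
exists (rnorm (x N) + 1); first by rewrite ltr_wpDl ?rnorm_ge0.
exists N => // n /= Nn; rewrite -(subnK Nn).
rewrite -[x _](subrK (shift (n - N) (x N))) addrC.
by rewrite (le_trans (rnormD _ _)) // lerD ?shift_iso.
Qed.

Lemma negligibleD x y : negligible x -> negligible y ->
  negligible (fun n => x n + y n).
Proof.
move=> x0 y0 e e0; have e2 : 0 < e / 2 by rewrite divr_gt0.
near=> n; rewrite (le_trans (rnormD _ _)) // [e]splitr lerD //.
  by near: n; exact: x0.
by near: n; exact: y0.
Unshelve. all: by end_near. Qed.

Lemma negligible_le x y (C : R) :
  (\forall n \near \oo, rnorm (y n) <= C * rnorm (x n)) ->
  negligible x -> negligible y.
Proof.
move=> yx x0 e e0; have C1 : 0 < `|C| + 1 by rewrite ltr_wpDl.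
near=> n.
have xn : rnorm (x n) <= e / (`|C| + 1) by near: n; apply: x0; rewrite divr_gt0.
rewrite (@le_trans _ _ (C * rnorm (x n))) //; first by near: n.
rewrite ler_pdivlMr // mulrC in xn; apply: le_trans xn.
by rewrite ler_wpM2r ?rnorm_ge0 // (le_trans (ler_norm _)) // lerDl.
Unshelve. all: by end_near. Qed.

Lemma negligibleN x : negligible x -> negligible (fun n => - x n).
Proof.
apply: (@negligible_le _ _ 1); near=> n; by rewrite rnormN mul1r.
Unshelve. all: by end_near. Qed.

Lemma negligible_subxx x : negligible (fun n => x n - x n).
Proof.
by move=> e e0; near=> n; rewrite subrr rnorm0 ltW.
Unshelve. all: by end_near. Qed.

Lemma negligible_sub_trans y x z : negligible (fun n => x n - y n) ->
  negligible (fun n => y n - z n) -> negligible (fun n => x n - z n).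
Proof.
move=> xy yz e e0; have e2 : 0 < e / 2 by rewrite divr_gt0.
near=> n; rewrite (le_trans (rnorm_dist3 _ (y n) _)) // [e]splitr lerD //.
  by near: n; exact: xy.
by near: n; exact: yz.
Unshelve. all: by end_near. Qed.

Lemma negligible_sub_sym x y : negligible (fun n => x n - y n) ->
  negligible (fun n => y n - x n).
Proof.
by move=> xy e e0; near=> n; rewrite rnorm_distC; near: n; exact: xy.
Unshelve. all: by end_near. Qed.

Lemma coherent0 : coherent (fun n => 0).
Proof.
move=> e e0; near=> n => k.
by rewrite (star_hom0 (shift_hom n k)) subr0 rnorm0 ltW.
Unshelve. all: by end_near. Qed.

Lemma coherentD x y : coherent x -> coherent y -> coherent (fun n => x n + y n).
Proof.
move=> xc yc e e0; have e2 : 0 < e / 2 by rewrite divr_gt0.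
near=> n => k; rewrite (star_homD (shift_hom n k)) opprD addrACA.
rewrite (le_trans (rnormD _ _)) // [e]splitr lerD //.
  by move: k; near: n; exact: xc.
by move: k; near: n; exact: yc.
Unshelve. all: by end_near. Qed.

Lemma coherentZ (c : R[i]) x : coherent x -> coherent (fun n => c *: x n).
Proof.
move=> xc e e0; have c1 : 0 < cabs c + 1 by rewrite ltr_wpDl ?cabs_ge0.
near=> n => k; rewrite (star_homZ (shift_hom n k)) -scalerBr rnormZ.
have : rnorm (x (k + n)%N - shift k (x n)) <= e / (cabs c + 1).
  by move: k; near: n; apply: xc; rewrite divr_gt0.
rewrite ler_pdivlMr // mulrC; apply: le_trans.
by rewrite ler_wpM2r ?rnorm_ge0 // lerDl.
Unshelve. all: by end_near. Qed.

Lemma coherentN x : coherent x -> coherent (fun n => - x n).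
Proof.
move=> xc e e0; near=> n => k.
rewrite (star_homN (shift_hom n k)) -opprD rnormN.
by move: k; near: n; exact: xc.
Unshelve. all: by end_near. Qed.

Lemma coherent_star x : coherent x -> coherent (fun n => cstar (x n)).
Proof.
move=> xc e e0; near=> n => k.
rewrite (star_homS (shift_hom n k)) -cstarB rnorm_cstar.
by move: k; near: n; exact: xc.
Unshelve. all: by end_near. Qed.

Lemma coherentM x y : coherent x -> coherent y ->
  coherent (fun n => cmul (x n) (y n)).
Proof.
move=> xc yc e e0.
have [C C0 xC] := coherent_bounded xc; have [C' C'0 yC] := coherent_bounded yc.
have CC : 0 < C + C' by rewrite addr_gt0.
near=> n => k; rewrite (star_homM (shift_hom n k)).
have -> : cmul (x (k + n)%N) (y (k + n)%N) - cmul (shift k (x n)) (shift k (y n))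
  = cmul (x (k + n)%N) (y (k + n)%N - shift k (y n)) +
    cmul (x (k + n)%N - shift k (x n)) (shift k (y n)).
  by rewrite cmulBr cmulBl addrA subrK.
rewrite (le_trans (rnormD _ _)) //.
have -> : e = C * (e / (C + C')) + (e / (C + C')) * C'.
  by rewrite [X in _ + X]mulrC -mulrDl mulrC divfK // gt_eqF.
rewrite lerD // (le_trans (rnorm_cmul _ _)) // ler_pM ?rnorm_ge0 //.
- move: k; near: n; case: xC => N _ NP; exists N => // n /= Nn k; apply: NP.
  exact: leq_trans Nn (leq_addl _ _).
- by move: k; near: n; apply: yc; rewrite divr_gt0.
- by move: k; near: n; apply: xc; rewrite divr_gt0.
- by rewrite shift_iso; near: n.
Unshelve. all: by end_near. Qed.

Definition tnorm x : R := limn (fun n => rnorm (x n)).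

Lemma tnorm_cvg x : coherent x -> (fun n => rnorm (x n)) @ \oo --> tnorm x.
Proof.
move=> xc; apply: real_cauchy_cvg => e e0.
have [N _ /(_ N (leqnn N)) xN] := xc _ (divr_gt0 e0 (ltr0n _ 2)).
suff H n : (N <= n)%N -> `|rnorm (x n) - rnorm (x N)| <= e / 2.
  exists N => m n Nm Nn; rewrite (le_trans (ler_distD (rnorm (x N)) _ _)) //.
  by rewrite [e]splitr lerD ?H // distrC H.
move=> Nn; rewrite -(subnK Nn) -(shift_iso (n - N) (x N)).
exact: le_trans (rnorm_dist_dist _ _) (xN _).
Qed.

Lemma tnorm_le x C : coherent x -> (\forall n \near \oo, rnorm (x n) <= C) ->
  tnorm x <= C.
Proof. by move=> /tnorm_cvg xc; apply: cvgr_to_le. Qed.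

Lemma tnorm_ge x C : coherent x -> (\forall n \near \oo, C <= rnorm (x n)) ->
  C <= tnorm x.
Proof. by move=> /tnorm_cvg xc; apply: cvgr_to_ge. Qed.

Lemma tnorm_near x e : coherent x -> 0 < e ->
  \forall n \near \oo, rnorm (x n) <= tnorm x + e.
Proof.
move=> xc e0; apply: (@cvgr_le _ _ _ _ _ _ (tnorm_cvg xc)).
by rewrite ltrDl.
Qed.

Lemma tnormP x : coherent x -> negligible x <-> tnorm x = 0.
Proof.
move=> xc; split => [x0|x0 e e0].
  apply/eqP; rewrite eq_le; apply/andP; split.
    by apply/ler_addgt0Pl => e e0; rewrite addr0; apply: tnorm_le => //; exact: x0.
  by apply: tnorm_ge => //; near=> n; exact: rnorm_ge0.
by have := tnorm_near xc e0; rewrite x0 add0r.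
Unshelve. all: by end_near. Qed.

Lemma tnorm_eq x y : coherent x -> coherent y ->
  negligible (fun n => x n - y n) -> tnorm x = tnorm y.
Proof.
move=> xc yc xy; apply: cvg_lim => //.
apply/cvgrPdist_le => e e0; have e2 : 0 < e / 2 by rewrite divr_gt0.
near=> n; rewrite (le_trans (ler_distD (rnorm (y n)) _ _)) // [e]splitr lerD //.
  near: n; have /cvgrPdist_le := tnorm_cvg yc; exact.
rewrite (le_trans (rnorm_dist_dist _ _)) // rnorm_distC; near: n; exact: xy.
Unshelve. all: by end_near. Qed.

(** A chosen element of the class of [x] modulo negligible threads. Equivalent threads have the same
    class, hence the same choice, so the quotient can be realized by the coherent fixed points of
    [normal_form]. *)
Definition normal_form x : thread :=
  xget (fun n => 0) [set y | coherent y /\ negligible (fun n => x n - y n)].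

Lemma normal_formP x : coherent x ->
  coherent (normal_form x) /\ negligible (fun n => x n - normal_form x n).
Proof.
move=> xc; apply: (@xgetPex _ (fun n => 0)
  [set y | coherent y /\ negligible (fun n => x n - y n)]).
by exists x; split => //; exact: negligible_subxx.
Qed.

Lemma normal_form_eq x y : negligible (fun n => x n - y n) ->
  normal_form x = normal_form y.
Proof.
move=> xy; rewrite /normal_form; congr xget; apply/seteqP.
split=> z /= [zc xz]; split=> //; last exact: negligible_sub_trans xy xz.
exact: negligible_sub_trans (negligible_sub_sym xy) xz.
Qed.

Definition dlim : Type := {x : thread | coherent x /\ normal_form x = x}.

Definition rep (a : dlim) : thread := sval a.

Lemma rep_coherent a : coherent (rep a). Proof. by case: (svalP a). Qed.

Lemma dlim_of_subproof x : coherent x ->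
  coherent (normal_form x) /\ normal_form (normal_form x) = normal_form x.
Proof.
move=> /normal_formP[yc xy]; split=> //; apply/esym.
exact: normal_form_eq xy.
Qed.

Definition cls x (xc : coherent x) : dlim := exist _ _ (dlim_of_subproof xc).

(** This relation is stable under all operations, so an identity in [dlim] reduces to the same
    identity at each index of representing threads. *)
Definition represents (a : dlim) x :=
  coherent x /\ negligible (fun n => rep a n - x n).

Lemma represents_cls x (xc : coherent x) : represents (cls xc) x.
Proof. by split => //; apply: negligible_sub_sym; case: (normal_formP xc). Qed.

Lemma represents_rep a : represents a (rep a).
Proof. by split; [exact: rep_coherent|exact: negligible_subxx]. Qed.

Lemma represents_eq a b x y : represents a x -> represents b y ->
  negligible (fun n => x n - y n) -> a = b.
Proof.
move=> [_ ax] [_ b_y] xy; have [_ ra] := svalP a; have [_ rb] := svalP b.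
have ab : rep a = rep b.
  rewrite /rep -ra -rb; apply: normal_form_eq.
  apply: negligible_sub_trans ax _; apply: negligible_sub_trans xy _.
  exact: negligible_sub_sym.
case: a b ab {ra rb ax b_y} => [a a'] [b b'] /= ab.
by move: a'; rewrite ab => a'; congr exist; exact: Prop_irrelevance.
Qed.

Lemma represents_ext a b x y : represents a x -> represents b y ->
  (forall n, x n = y n) -> a = b.
Proof.
move=> ax b_y xy; apply: represents_eq ax b_y _ => e e0.
by near=> n; rewrite xy subrr rnorm0 ltW.
Unshelve. all: by end_near. Qed.

Definition dzero := cls coherent0.
Definition dadd a b := cls (coherentD (rep_coherent a) (rep_coherent b)).
Definition dopp a := cls (coherentN (rep_coherent a)).
Definition dscale c a := cls (coherentZ c (rep_coherent a)).
Definition dmul a b := cls (coherentM (rep_coherent a) (rep_coherent b)).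
Definition dstar a := cls (coherent_star (rep_coherent a)).
Definition dnorm a := tnorm (rep a).

Lemma represents0 : represents dzero (fun n => 0).
Proof. exact: represents_cls. Qed.

Lemma representsD a b x y : represents a x -> represents b y ->
  represents (dadd a b) (fun n => x n + y n).
Proof.
move=> [xc ax] [yc b_y]; split; first exact: coherentD.
apply: negligible_sub_trans (represents_cls _).2 _.
move=> e /(negligibleD ax b_y).
by apply: filterS => n; rewrite opprD addrACA.
Qed.

Lemma representsN a x : represents a x -> represents (dopp a) (fun n => - x n).
Proof.
move=> [xc ax]; split; first exact: coherentN.
apply: negligible_sub_trans (represents_cls _).2 _.
by move=> e /(negligibleN ax); apply: filterS => n; rewrite opprD.
Qed.

Lemma representsZ c a x : represents a x ->
  represents (dscale c a) (fun n => c *: x n).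
Proof.
move=> [xc ax]; split; first exact: coherentZ.
apply: negligible_sub_trans (represents_cls _).2 _.
apply: (@negligible_le _ _ (cabs c)) ax.
by near=> n; rewrite -scalerBr rnormZ.
Unshelve. all: by end_near. Qed.

Lemma representsS a x : represents a x ->
  represents (dstar a) (fun n => cstar (x n)).
Proof.
move=> [xc ax]; split; first exact: coherent_star.
apply: negligible_sub_trans (represents_cls _).2 _.
apply: (@negligible_le _ _ 1) ax.
by near=> n; rewrite -cstarB rnorm_cstar mul1r.
Unshelve. all: by end_near. Qed.

Lemma representsM a b x y : represents a x -> represents b y ->
  represents (dmul a b) (fun n => cmul (x n) (y n)).
Proof.
move=> [xc ax] [yc b_y]; split; first exact: coherentM.
apply: negligible_sub_trans (represents_cls _).2 _.
apply: (@negligible_sub_trans (fun n => cmul (rep a n) (y n))).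
  have [C C0 aC] := coherent_bounded (rep_coherent a).
  apply: (@negligible_le _ _ C) b_y.
  near=> n; rewrite -cmulBr (le_trans (rnorm_cmul _ _)) //.
  by rewrite ler_wpM2r ?rnorm_ge0 //; near: n.
have [C C0 yC] := coherent_bounded yc.
apply: (@negligible_le _ _ C) ax.
near=> n; rewrite -cmulBl (le_trans (rnorm_cmul _ _)) // mulrC.
by rewrite ler_wpM2r ?rnorm_ge0 //; near: n.
Unshelve. all: by end_near. Qed.

Lemma dnormE a x : represents a x -> dnorm a = tnorm x.
Proof. by move=> [xc ax]; apply: tnorm_eq => //; exact: rep_coherent. Qed.

Local Notation rr := represents_rep.

Fact daddA : associative dadd.
Proof.
move=> a b c; apply: represents_ext
  (representsD (rr a) (representsD (rr b) (rr c)))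
  (representsD (representsD (rr a) (rr b)) (rr c)) _ => n; exact: addrA.
Qed.

Fact daddC : commutative dadd.
Proof.
move=> a b; apply: represents_ext (representsD (rr a) (rr b))
  (representsD (rr b) (rr a)) _ => n; exact: addrC.
Qed.

Fact dadd0 : left_id dzero dadd.
Proof.
move=> a; apply: represents_ext (representsD represents0 (rr a)) (rr a) _ => n.
exact: add0r.
Qed.

Fact daddN : left_inverse dzero dopp dadd.
Proof.
move=> a; apply: represents_ext (representsD (representsN (rr a)) (rr a))
  represents0 _ => n; exact: addNr.
Qed.

HB.instance Definition _ := gen_eqMixin dlim.
HB.instance Definition _ := gen_choiceMixin dlim.
HB.instance Definition _ := GRing.isZmodule.Build dlim daddA daddC dadd0 daddN.

Fact dscaleA c c' a : dscale c (dscale c' a) = dscale (c * c') a.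
Proof.
apply: represents_ext (representsZ c (representsZ c' (rr a)))
  (representsZ (c * c') (rr a)) _ => n; exact: scalerA.
Qed.

Fact dscale1 : left_id 1 dscale.
Proof.
move=> a; apply: represents_ext (representsZ 1 (rr a)) (rr a) _ => n.
exact: scale1r.
Qed.

Fact dscaleDr : right_distributive dscale +%R.
Proof.
move=> c a b; apply: represents_ext (representsZ c (representsD (rr a) (rr b)))
  (representsD (representsZ c (rr a)) (representsZ c (rr b))) _ => n.
exact: scalerDr.
Qed.

Fact dscaleDl a : {morph dscale^~ a : c c' / c + c'}.
Proof.
move=> c c'; apply: represents_ext (representsZ (c + c') (rr a))
  (representsD (representsZ c (rr a)) (representsZ c' (rr a))) _ => n.
exact: scalerDl.
Qed.

HB.instance Definition _ := GRing.Zmodule_isLmodule.Build R[i] dlim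
  dscaleA dscale1 dscaleDr dscaleDl.

Fact dnormD (a b : dlim) : dnorm (a + b) <= dnorm a + dnorm b.
Proof.
have ac := rep_coherent a; have bc := rep_coherent b.
rewrite (dnormE (representsD (rr a) (rr b))).
apply/ler_addgt0Pr => e e0; have e2 : 0 < e / 2 by rewrite divr_gt0.
apply: tnorm_le; first exact: coherentD.
near=> n; rewrite (le_trans (rnormD _ _)) // [e]splitr addrACA lerD //.
  by near: n; exact: tnorm_near.
by near: n; exact: tnorm_near.
Unshelve. all: by end_near. Qed.

Fact dnormZ (c : R[i]) (a : dlim) : dnorm (c *: a) = cabs c * dnorm a.
Proof.
rewrite (dnormE (representsZ c (rr a))); apply: cvg_lim => //.
under eq_fun do rewrite rnormZ.
by apply: cvgMr; exact: tnorm_cvg (rep_coherent a).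
Qed.

Fact dnorm_distC (a b : dlim) : dnorm (a - b) = dnorm (b - a).
Proof. by rewrite -opprB -scaleN1r dnormZ cabsN cabs1 mul1r. Qed.

Fact dnorm_dist3 (a b c : dlim) : dnorm (a - c) <= dnorm (a - b) + dnorm (b - c).
Proof. by have := dnormD (a - b) (b - c); rewrite addrA subrK. Qed.

Fact dnorm_eq0 (a : dlim) : dnorm a = 0 -> a = 0.
Proof.
move=> /(tnormP (rep_coherent a)) a0.
apply: represents_eq (rr a) represents0 _ => e /a0.
by apply: filterS => n; rewrite subr0.
Qed.

(** Take for [j n] the largest [i <= n] with [M i <= n] (0 if there is none). It tends to infinity,
    yet slowly enough for [M (j n) <= n] to hold once some index qualifies. *)
Lemma last_index (M : nat -> nat) : exists j : nat -> nat,
  forall i n, (i <= n)%N -> (M i <= n)%N -> (i <= j n)%N /\ (M (j n) <= n)%N.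
Proof.
pose P n (i : 'I_n.+1) := (M i <= n)%N.
exists (fun n => \max_(i < n.+1 | P n i) i) => i n ni Mi.
have iP : P n (inord i) by rewrite /P inordK.
split; first by rewrite -[X in (X <= _)%N](@inordK n) // (leq_bigmax_cond (inord i)).
have [|k kP ->] := @eq_bigmax_cond _ (P n) (fun i => val i); last exact: kP.
by apply/card_gt0P; exists (inord i).
Qed.

Lemma near_all_leq (P : nat -> nat -> Prop) j :
  (forall i, \forall n \near \oo, P i n) ->
  \forall n \near \oo, forall i, (i <= j)%N -> P i n.
Proof.
move=> Pn; elim: j => [|j IHj].
  by near=> n => i; rewrite leqn0 => /eqP ->; near: n.
near=> n => i; rewrite leq_eqVlt => /orP[/eqP ->|]; first by near: n.
by rewrite ltnS; move: i; near: n.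
Unshelve. all: by end_near. Qed.

(* Diagonal argument: the limit thread follows, at the index n, the best
   approximating thread whose estimates are already valid from n on. *)
Fact dnorm_complete (u : nat -> dlim) :
  cauchy_for dnorm u -> exists a, cvg_for dnorm u a.
Proof.
move=> uc.
have [q [q0 q_le q_small]] : exists q : nat -> R, [/\ forall i, 0 < q i,
    forall i k, (i <= k)%N -> q k <= q i &
    forall e, 0 < e -> exists i, q i <= e].
  exists (fun i => i.+1%:R^-1); split=> [i|i k ik|e e0].
  - by rewrite invr_gt0 ltr0n.
  - by rewrite lef_pV2 ?posrE ?ltr0n // ler_nat ltnS.
  - have [N _ NP] := near_infty_natSinv_lt (PosNum e0).
    by exists N; apply/ltW/NP => /=.
have [g gP] := choice (fun i => uc _ (q0 i)).
pose x i := rep (u (g i)).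
have xc i : coherent (x i) := rep_coherent _.
(* Passing through [u m] with [m] large costs [q i + q j]; the last [q j] allows for the gap between
   the norms at [n] and their limit. *)
have xx i j : \forall n \near \oo, rnorm (x i n - x j n) <= q i + q j + q j.
  have [m [im jm]] : exists m, (g i <= m)%N /\ (g j <= m)%N.
    by exists (maxn (g i) (g j)); rewrite leq_maxl leq_maxr.
  have xm i' : (g i' <= m)%N -> dnorm (u (g i') - u m) <= q i'.
    by move=> im'; apply: gP.
  have := representsD (rr (u (g i))) (representsN (rr (u (g j)))).
  rewrite -[dadd _ _]/(u (g i) - u (g j)) => rep_ij.
  have ij : dnorm (u (g i) - u (g j)) <= q i + q j.
    apply: le_trans (dnorm_dist3 _ (u m) _) _; apply: lerD; first exact: xm.
    by rewrite dnorm_distC; exact: xm.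
  have := tnorm_near rep_ij.1 (q0 j); apply: filterS => n /le_trans; apply.
  by rewrite lerD2r -(dnormE rep_ij).
have Mex j : exists m : nat, forall n, (m <= n)%N ->
    (forall k, rnorm (x j (k + n)%N - shift k (x j n)) <= q j) /\
    (forall i, (i <= j)%N -> rnorm (x i n - x j n) <= q i + q j + q j).
  have [N1 _ N1P] := xc j _ (q0 j).
  have [N2 _ N2P] := near_all_leq j (xx^~ j).
  exists (maxn N1 N2) => n; rewrite geq_max => /andP[n1 n2].
  by split; [exact: N1P|exact: N2P].
have [M MP] := choice Mex; have [j jP] := last_index M.
pose y : thread := fun n => x (j n) n.
(* Here [i <= j n] and [q] is decreasing, so the estimate at [j n] is at most [3 * q i]. *)
have xy i : \forall n \near \oo, rnorm (x i n - y n) <= 3 * q i.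
  exists (maxn i (M i)) => // n /=; rewrite geq_max => /andP[ni nM].
  have [ij Mj] := jP _ _ ni nM.
  have := (MP _ _ Mj).2 _ ij; rewrite -/(y n) => /le_trans; apply.
  have := q_le _ _ ij; lra.
have yc : coherent y.
  move=> e e0; have [i iP] := q_small _ (divr_gt0 e0 (ltr0n _ 7)).
  (* Three sevenths for replacing [y] by [x i] at each of the two indices, and one for the coherence
     of [x i]. *)
  have eE : e = 3 * (e / 7) + (e / 7 + 3 * (e / 7)) by field.
  near=> n => k; rewrite eE.
  rewrite (le_trans (rnorm_dist3 _ (x i (k + n)%N) _)) // lerD //.
    rewrite rnorm_distC (@le_trans _ _ (3 * q i)) // ?ler_pM2l //.
    move: k; near: n; case: (xy i) => N _ NP; exists N => // n /= Nn k.
    by apply: NP; exact: leq_trans Nn (leq_addl _ _).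
  rewrite (le_trans (rnorm_dist3 _ (shift k (x i n)) _)) // lerD //.
    by move: k; near: n; apply: xc; rewrite divr_gt0.
  rewrite -(star_homB (shift_hom n k)) shift_iso.
  rewrite (@le_trans _ _ (3 * q i)) // ?ler_pM2l //.
  by near: n; exact: xy.
exists (cls yc) => e e0; have [i iP] := q_small _ (divr_gt0 e0 (ltr0n _ 4)).
exists (g i) => n gn.
apply: le_trans (dnorm_dist3 _ (u (g i)) _) _.
have -> : e = e / 4 + 3 * (e / 4) by field.
apply: lerD; first by apply: le_trans iP; exact: gP.
have := representsD (rr (u (g i))) (representsN (represents_cls yc)).
rewrite -[dadd _ _]/(u (g i) - cls yc) => rep_iy.
rewrite (dnormE rep_iy) (@le_trans _ _ (3 * q i)) // ?ler_pM2l //.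
by apply: tnorm_le; [exact: rep_iy.1|exact: xy].
Unshelve. all: by end_near. Qed.

HB.instance Definition _ := Lmodule_isRealNormedComplete.Build R dlim
  dnormD dnormZ dnorm_eq0 dnorm_complete.

Fact dmulA : associative dmul.
Proof.
move=> a b c; apply: represents_ext
  (representsM (rr a) (representsM (rr b) (rr c)))
  (representsM (representsM (rr a) (rr b)) (rr c)) _ => n; exact: cmulA.
Qed.

Fact dmulDl : left_distributive dmul +%R.
Proof.
move=> a b c; apply: represents_ext
  (representsM (representsD (rr a) (rr b)) (rr c))
  (representsD (representsM (rr a) (rr c)) (representsM (rr b) (rr c))) _ => n.
exact: cmulDl.
Qed.

Fact dmulDr : right_distributive dmul +%R.
Proof.
move=> a b c; apply: represents_ext
  (representsM (rr a) (representsD (rr b) (rr c)))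
  (representsD (representsM (rr a) (rr b)) (representsM (rr a) (rr c))) _ => n.
exact: cmulDr.
Qed.

Fact dscaleAl (k : R[i]) (a b : dlim) : k *: dmul a b = dmul (k *: a) b.
Proof.
apply: represents_ext (representsZ k (representsM (rr a) (rr b)))
  (representsM (representsZ k (rr a)) (rr b)) _ => n; exact: cscaleAl.
Qed.

Fact dscaleAr (k : R[i]) (a b : dlim) : k *: dmul a b = dmul a (k *: b).
Proof.
apply: represents_ext (representsZ k (representsM (rr a) (rr b)))
  (representsM (rr a) (representsZ k (rr b))) _ => n; exact: cscaleAr.
Qed.

Fact dstarK : involutive dstar.
Proof.
move=> a; apply: represents_ext (representsS (representsS (rr a))) (rr a) _ => n.
exact: cstarK.
Qed.

Fact dstarD : {morph dstar : a b / a + b}.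
Proof.
move=> a b; apply: represents_ext (representsS (representsD (rr a) (rr b)))
  (representsD (representsS (rr a)) (representsS (rr b))) _ => n; exact: cstarD.
Qed.

Fact dstarZ (k : R[i]) (a : dlim) : dstar (k *: a) = Num.conj k *: dstar a.
Proof.
apply: represents_ext (representsS (representsZ k (rr a)))
  (representsZ (Num.conj k) (representsS (rr a))) _ => n; exact: cstarZ.
Qed.

Fact dstarM a b : dstar (dmul a b) = dmul (dstar b) (dstar a).
Proof.
apply: represents_ext (representsS (representsM (rr a) (rr b)))
  (representsM (representsS (rr b)) (representsS (rr a))) _ => n; exact: cstarM.
Qed.

Lemma dlim_normE (a : dlim) : `|a| = (dnorm a)%:C%C.
Proof. by []. Qed.

Lemma dlim_rnormE (a : dlim) x : represents a x -> rnorm a = tnorm x.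
Proof. by move=> /dnormE <-. Qed.

Fact dnormM (a b : dlim) : `|dmul a b| <= `|a| * `|b|.
Proof.
rewrite !dlim_normE -real_complexM lecR.
have ac := tnorm_cvg (rep_coherent a); have bc := tnorm_cvg (rep_coherent b).
have rM := representsM (rr a) (rr b).
rewrite (dnormE rM) /dnorm -(cvg_lim _ (cvgM ac bc)) //.
apply: ler_lim.
- exact: cvgP (tnorm_cvg rM.1).
- exact: cvgP (cvgM ac bc).
- by near=> n; exact: rnorm_cmul.
Unshelve. all: by end_near. Qed.

Fact dnorm_star_mul (a : dlim) : `|dmul (dstar a) a| = `|a| ^+ 2.
Proof.
rewrite !dlim_normE -real_complexX; congr (_%:C%C).
have ac := tnorm_cvg (rep_coherent a).
rewrite (dnormE (representsM (representsS (rr a)) (rr a))).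
apply: cvg_lim => //; under eq_fun do rewrite rnorm_cstar_mul expr2.
rewrite expr2; exact: (cvgM ac ac).
Qed.

HB.instance Definition _ := CompleteNormedModule_isCStarAlgebra.Build R dlim
  dmulA dmulDl dmulDr dscaleAl dscaleAr dnormM dstarK dstarD dstarZ dstarM
  dnorm_star_mul.

(** The pattern [ReflectT nm] provides the proof of [n <= m] that the cast needs. Below [n] the
    thread has the default value 0; classes depend on tails alone. *)
Definition thread_from n (d : D n) : thread := fun m =>
  if (n <= m)%N =P true is ReflectT nm then
    ecast i (D i) (subnK nm) (shift (m - n) d)
  else 0.

Lemma thread_fromE n (d : D n) k : thread_from d (k + n)%N = shift k d.
Proof.
rewrite /thread_from; case: eqP => [nm|]; last by rewrite leq_addl.
move: (subnK nm); move: (k + n - n)%N => j e.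
have jk : j = k := addIn e.
by rewrite -jk in e *; rewrite (eq_irrelevance e (erefl _)).
Qed.

Lemma thread_from_step n (d : D n) m : (n <= m)%N ->
  thread_from d m.+1 = sysf (thread_from d m).
Proof.
by move=> /subnK <-; rewrite thread_fromE; exact: (thread_fromE d (m - n).+1).
Qed.

Lemma thread_from_shift n (d : D n) m k : (n <= m)%N ->
  thread_from d (k + m)%N = shift k (thread_from d m).
Proof.
move=> nm; elim: k => //= k <-; apply: thread_from_step.
exact: leq_trans nm (leq_addl _ _).
Qed.

Lemma thread_from_coherent n (d : D n) : coherent (thread_from d).
Proof.
move=> e e0; exists n => // m /= nm k.
by rewrite thread_from_shift // subrr rnorm0 ltW.
Qed.

Definition dlim_in n (d : D n) : dlim := cls (thread_from_coherent d).

Lemma represents_in n (d : D n) : represents (dlim_in d) (thread_from d).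
Proof. exact: represents_cls. Qed.

Lemma represents_from N a b x y : represents a x -> represents b y ->
  (forall k, x (k + N)%N = y (k + N)%N) -> a = b.
Proof.
move=> ax b_y xy; apply: represents_eq ax b_y _ => e e0; exists N => // n /= Nn.
by rewrite -(subnK Nn) xy subrr rnorm0 ltW.
Qed.

Lemma dlim_in_hom n : is_star_hom (@dlim_in n).
Proof.
split=> [c d d'|d d'|d].
- apply: (represents_from (N := n) (represents_in _) (representsD
    (representsZ c (represents_in d)) (represents_in d'))) => k.
  by rewrite !thread_fromE (star_homP (shift_hom n k)).
- apply: (represents_from (N := n) (represents_in _) (representsM
    (represents_in d) (represents_in d'))) => k.
  by rewrite !thread_fromE (star_homM (shift_hom n k)).
- apply: (represents_from (N := n) (represents_in _)
    (representsS (represents_in d))) => k.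
  by rewrite !thread_fromE (star_homS (shift_hom n k)).
Qed.

Lemma dlim_in_compat n (d : D n) : dlim_in (sysf d) = dlim_in d.
Proof.
apply: (represents_from (N := n.+1) (represents_in _) (represents_in _)) => k.
rewrite thread_fromE thread_from_shift //; congr shift.
exact/esym/(thread_fromE d 1).
Qed.

Lemma dlim_in_iso n (d : D n) : rnorm (dlim_in d) = rnorm d.
Proof.
rewrite (dlim_rnormE (represents_in d)); apply: cvg_lim => //.
apply: cvg_near_cst; exists n => // m /= nm.
by rewrite -(subnK nm) thread_fromE shift_iso.
Qed.

(** Coherence puts [x m] within [e] of the thread started at [x n], for all [m >= n] at once, and
    this bound passes to the limit of the norms. *)
Lemma dlim_in_cvg a x : represents a x ->
  cvg_for (@rnorm R dlim) (fun n => dlim_in (x n)) a.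
Proof.
move=> ax e e0; have [N _ NP] := ax.1 _ e0; exists N => n Nn.
have := representsD (represents_in (x n)) (representsN ax).
rewrite -[dadd _ _]/(dlim_in (x n) - a) => rep_n; rewrite (dlim_rnormE rep_n).
apply: tnorm_le; first exact: rep_n.1.
exists n => // m /= nm; rewrite -(subnK nm) thread_fromE rnorm_distC.
exact: NP.
Qed.

Lemma dlim_in_dense (a : dlim) e : 0 < e ->
  exists n (d : D n), rnorm (a - dlim_in d) <= e.
Proof.
move=> /(dlim_in_cvg (rr a))[N NP]; exists N, (rep a N).
by rewrite rnorm_distC NP.
Qed.

(** * The universal property of the limit *)

Section Universal.
Variables (C : cstarAlgType R) (psi : forall n, D n -> C).
Hypothesis psi_cocone : is_cocone (@sysf R S) psi.

Lemma cocone_shift n k (d : D n) : psi (shift k d) = psi d.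
Proof. by elim: k => //= k <-; case: psi_cocone => _ ->. Qed.

(** Homomorphisms are contractive, so the estimates in the definition of [coherent] carry over to
    the images in [C]. *)
Lemma cocone_cauchy x : coherent x ->
  exists c, cvg_for (@rnorm R C) (fun n => psi (x n)) c.
Proof.
move=> xc; apply: rnorm_complete => e e0.
have [N _ /(_ N (leqnn N)) NP] := xc _ (divr_gt0 e0 (ltr0n _ 2)).
have H m : (N <= m)%N -> rnorm (psi (x m) - psi (x N)) <= e / 2.
  move=> /subnK <-; rewrite -(cocone_shift (m - N) (x N)).
  have psi_hom := psi_cocone.1 (m - N + N)%N.
  by rewrite -(star_homB psi_hom) (le_trans (star_hom_contractive psi_hom _)).
exists N => m n Nm Nn; rewrite (le_trans (rnorm_dist3 _ (psi (x N)) _)) //.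
by rewrite [e]splitr lerD ?H // rnorm_distC H.
Qed.

Definition dlim_map (a : dlim) : C := sval (cid (cocone_cauchy (rep_coherent a))).

Lemma dlim_mapP a x : represents a x ->
  cvg_for (@rnorm R C) (fun n => psi (x n)) (dlim_map a).
Proof.
move=> [xc ax]; have := svalP (cid (cocone_cauchy (rep_coherent a))).
rewrite -/(dlim_map a) => ac e e0; have e2 : 0 < e / 2 by rewrite divr_gt0.
have [N NP] := ac _ e2; have [M _ MP] := ax _ e2.
exists (maxn N M) => n; rewrite geq_max => /andP[Nn Mn].
rewrite (le_trans (rnorm_dist3 _ (psi (rep a n)) _)) // [e]splitr lerD ?NP //.
have psi_hom := psi_cocone.1 n.
rewrite -(star_homB psi_hom) (le_trans (star_hom_contractive psi_hom _)) //.
by rewrite rnorm_distC; exact: MP.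
Qed.

Lemma dlim_map_hom : is_star_hom dlim_map.
Proof.
have hom n := psi_cocone.1 n.
split=> [c a b|a b|a].
- apply: cvg_for_unique (dlim_mapP (representsD (representsZ c (rr a)) (rr b))) _.
  under eq_fun do rewrite (star_homP (hom _)).
  exact: cvg_forD (cvg_forZ c (dlim_mapP (rr a))) (dlim_mapP (rr b)).
- apply: cvg_for_unique (dlim_mapP (representsM (rr a) (rr b))) _.
  under eq_fun do rewrite (star_homM (hom _)).
  exact: cvg_for_cmul (dlim_mapP (rr a)) (dlim_mapP (rr b)).
- apply: cvg_for_unique (dlim_mapP (representsS (rr a))) _.
  under eq_fun do rewrite (star_homS (hom _)).
  exact: cvg_for_cstar (dlim_mapP (rr a)).
Qed.

Lemma dlim_map_in n (d : D n) : dlim_map (dlim_in d) = psi d.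
Proof.
apply: cvg_for_unique (dlim_mapP (represents_in d)) _.
apply: (@cvg_for_eventually _ _ n _ _ _ _ (cvg_for_cst (psi d))) => m nm.
by rewrite -(subnK nm) thread_fromE cocone_shift.
Qed.

(** A homomorphism is continuous, and each element is the limit of the images of its representing
    thread. *)
Lemma dlim_map_unique (g : dlim -> C) : is_star_hom g ->
  (forall n (d : D n), g (dlim_in d) = psi d) -> g = dlim_map.
Proof.
move=> g_hom g_in; apply/funext => a.
apply: cvg_for_unique (cvg_for_star_hom g_hom (dlim_in_cvg (rr a))) _.
rewrite /comp; under eq_fun do rewrite g_in.
exact: dlim_mapP (rr a).
Qed.

End Universal.

Theorem dlim_direct_limit : is_direct_limit (@sysf R S) dlim_in.
Proof.
split; first by split; [exact: dlim_in_hom|exact: dlim_in_compat].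
move=> C psi psi_cocone; exists (dlim_map psi_cocone); split.
  by split; [exact: dlim_map_hom|exact: dlim_map_in].
by move=> g [g_hom g_in]; apply/esym; exact: dlim_map_unique.
Qed.

End Threads.

(** * Algebras of block diagonal matrices *)

Lemma sum_neq0 (R : realType) (J : finType) (F : J -> R[i]) :
  \sum_j F j != 0 -> exists j, F j != 0.
Proof.
move=> F0; apply/existsP; apply: contraNT F0; rewrite negb_exists => /forallP F0.
by apply/eqP/big1 => j _; apply/eqP; have := F0 j; rewrite negbK.
Qed.

(** * The Euclidean norm and the Cauchy-Schwarz inequality *)

Section EuclideanNorm.
Variables (R : realType) (X : finType).
Implicit Types (u v : X -> R[i]).

(** With [A] and [B] the two square roots, sum [2 A B a b <= B^2 a^2 + A^2 b^2] over [x] and divide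
    by [2 A B]. If [A B = 0], one of the families vanishes. *)
Lemma sum_mul_le_sqrt (a b : X -> R) :
  (forall x, 0 <= a x) -> (forall x, 0 <= b x) ->
  \sum_x a x * b x <=
    Num.sqrt (\sum_x a x ^+ 2) * Num.sqrt (\sum_x b x ^+ 2).
Proof.
move=> a0 b0; set A := Num.sqrt _; set B := Num.sqrt _.
have sq0 (c : X -> R) : 0 <= \sum_x c x ^+ 2.
  by apply: sumr_ge0 => x _; exact: sqr_ge0.
have A2 : A ^+ 2 = \sum_x a x ^+ 2 by rewrite sqr_sqrtr.
have B2 : B ^+ 2 = \sum_x b x ^+ 2 by rewrite sqr_sqrtr.
have A0 : 0 <= A := sqrtr_ge0 _; have B0 : 0 <= B := sqrtr_ge0 _.
have eq0 (c : X -> R) : \sum_x c x ^+ 2 = 0 -> forall x, c x = 0.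
  move=> /eqP; rewrite psumr_eq0; last by move=> x _; exact: sqr_ge0.
  by move=> /allP c0 x; apply/eqP; rewrite -sqrf_eq0; apply: c0; rewrite mem_index_enum.
have [AB0|AB0] := eqVneq (A * B) 0.
  rewrite AB0 big1 // => x _; move/eqP: AB0; rewrite mulf_eq0 => /orP[]/eqP AB0.
    by rewrite (eq0 a) ?mul0r // -A2 AB0 expr0n.
  by rewrite (eq0 b) ?mulr0 // -B2 AB0 expr0n.
have AB_gt0 : 0 < 2 * (A * B).
  by rewrite mulr_gt0 // lt_neqAle eq_sym AB0 mulr_ge0.
rewrite -(ler_pM2l AB_gt0) mulr_sumr.
have -> : 2 * (A * B) * (A * B) = B ^+ 2 * A ^+ 2 + A ^+ 2 * B ^+ 2 by ring.
rewrite {1}A2 {2}B2 !mulr_sumr -big_split ler_sum // => x _.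
by have := sqr_ge0 (B * a x - A * b x) => /=; lra.
Qed.

Definition l2norm u : R := Num.sqrt (\sum_x cabs (u x) ^+ 2).

Lemma l2norm_ge0 u : 0 <= l2norm u. Proof. exact: sqrtr_ge0. Qed.

Lemma l2norm_sqr u : l2norm u ^+ 2 = \sum_x cabs (u x) ^+ 2.
Proof. by rewrite sqr_sqrtr // sumr_ge0 // => x _; exact: sqr_ge0. Qed.

Lemma l2norm_sqrC u : (l2norm u ^+ 2)%:C%C = \sum_x Num.conj (u x) * u x.
Proof.
rewrite l2norm_sqr raddf_sum; apply: eq_bigr => x _.
by rewrite conjC_mul_self.
Qed.

Lemma cabs_sum I (r : seq I) (F : I -> R[i]) :
  cabs (\sum_(i <- r) F i) <= \sum_(i <- r) cabs (F i).
Proof.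
elim: r => [|i r IHr]; first by rewrite !big_nil cabs0.
by rewrite !big_cons (le_trans (cabsD _ _)) // lerD2l.
Qed.

Lemma cauchy_schwarz_l2norm u v :
  cabs (\sum_x Num.conj (u x) * v x) <= l2norm u * l2norm v.
Proof.
rewrite (le_trans (cabs_sum _ _)) //.
under eq_bigr do rewrite cabsM cabs_conj.
by apply: sum_mul_le_sqrt => x; exact: cabs_ge0.
Qed.

Lemma l2normD u v : l2norm (fun x => u x + v x) <= l2norm u + l2norm v.
Proof.
rewrite -ler_sqr ?nnegrE ?addr_ge0 ?l2norm_ge0 // sqrrD !l2norm_sqr.
have CS := sum_mul_le_sqrt (fun x => cabs_ge0 (u x)) (fun x => cabs_ge0 (v x)).
apply: (@le_trans _ _ (\sum_x cabs (u x) ^+ 2 +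
  (\sum_x cabs (u x) * cabs (v x)) *+ 2 + \sum_x cabs (v x) ^+ 2)); last first.
  by rewrite lerD2r lerD2l lerMn2r.
rewrite -sumrMnl -!big_split /= ler_sum // => x _.
by rewrite -sqrrD ler_sqr ?nnegrE ?addr_ge0 ?cabs_ge0 // cabsD.
Qed.

Lemma l2normZ (k : R[i]) u : l2norm (fun x => k * u x) = cabs k * l2norm u.
Proof.
rewrite /l2norm -[cabs k]ger0_norm ?cabs_ge0 // -sqrtr_sqr -sqrtrM ?sqr_ge0 //.
by rewrite mulr_sumr; under eq_bigr do rewrite cabsM exprMn.
Qed.

Lemma cabs_le_l2norm u x : cabs (u x) <= l2norm u.
Proof.
rewrite -ler_sqr ?nnegrE ?l2norm_ge0 ?cabs_ge0 // l2norm_sqr (bigD1 x) //=.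
by rewrite lerDl sumr_ge0 // => y _; exact: sqr_ge0.
Qed.

Lemma l2norm_le_sum u : l2norm u <= \sum_x cabs (u x).
Proof.
have s0 : 0 <= \sum_x cabs (u x) by rewrite sumr_ge0 // => x _; exact: cabs_ge0.
rewrite -ler_sqr ?nnegrE ?l2norm_ge0 // l2norm_sqr expr2 mulr_suml.
rewrite ler_sum // => x _; rewrite expr2 ler_wpM2l ?cabs_ge0 //.
by rewrite (bigD1 x) //= lerDl sumr_ge0 // => y _; exact: cabs_ge0.
Qed.

Lemma l2norm0 : l2norm (fun=> 0) = 0.
Proof. by rewrite /l2norm big1 ?sqrtr0 // => x _; rewrite cabs0 expr0n. Qed.

Lemma l2norm_eq0 u x : l2norm u = 0 -> u x = 0.
Proof.
move=> u0; apply: cabs_eq0; apply/eqP; rewrite eq_le cabs_ge0 andbT.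
by rewrite -u0 cabs_le_l2norm.
Qed.

End EuclideanNorm.

Lemma complex_cauchy_cvg (R : realType) (u : nat -> R[i]) :
  cauchy_for (@cabs R) u -> exists a, cvg_for (@cabs R) u a.
Proof.
move=> uc.
have re_c : cvgn (fun n => complex.Re (u n)).
  apply: real_cauchy_cvg => e /uc[N NP]; exists N => m n Nm Nn.
  by rewrite -raddfB (le_trans (cabs_Re_le _)) ?NP.
have im_c : cvgn (fun n => complex.Im (u n)).
  apply: real_cauchy_cvg => e /uc[N NP]; exists N => m n Nm Nn.
  by rewrite -raddfB (le_trans (cabs_Im_le _)) ?NP.
exists (Complex (limn (fun n => complex.Re (u n))) (limn (fun n => complex.Im (u n)))).
move=> e e0; have e2 : 0 < e / 2 by rewrite divr_gt0.
have /cvgrPdist_le/(_ _ e2)[N _ NP] := re_c.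
have /cvgrPdist_le/(_ _ e2)[M _ MP] := im_c.
exists (maxn N M) => n; rewrite geq_max => /andP[/NP Nn /MP Mn].
rewrite (le_trans (cabs_le_ReIm _)) // [e]splitr lerD //.
  by rewrite raddfB distrC.
by rewrite raddfB distrC.
Qed.

(* Block diagonal matrices: the rows and columns are indexed by X, and the
   fibres of r are the blocks.  An entry is stored for each pair of indices in
   the same block. *)
Definition blocks (R : realType) (X : finType) (V : eqType) (r : X -> V) : Type :=
  {ffun {p : X * X | r p.1 == r p.2} -> R[i]^o}.

Section Blocks.
Variables (R : realType) (X : finType) (V : eqType) (r : X -> V).
Local Notation D := (blocks R r).
Local Notation pair_in_block := {p : X * X | r p.1 == r p.2}.
Implicit Types (x y z : X) (u v : X -> R[i]).

HB.instance Definition _ := GRing.Lmodule.copy D {ffun pair_in_block -> R[i]^o}.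
Implicit Types (a b c : D).

(** The extension by 0 to pairs from different blocks makes products plain sums over [X]. *)
Definition entry a x y : R[i] :=
  if insub (x, y) is Some p then a p else 0.

Definition of_entries (g : X -> X -> R[i]) : D :=
  [ffun p => g (val p).1 (val p).2].

Lemma entry_of_entries g x y :
  entry (of_entries g) x y = if r x == r y then g x y else 0.
Proof.
rewrite /entry; case: insubP => [p rxy pE|/negbTE /= ->//].
by move: rxy => /= ->; rewrite ffunE pE.
Qed.

Lemma entry_off_block a x y : r x != r y -> entry a x y = 0.
Proof. by move=> rxy; rewrite /entry insubF //= (negbTE rxy). Qed.

Lemma entry_neq0 a x y : entry a x y != 0 -> r x = r y.
Proof. by move=> axy; apply/eqP; apply: contraNT axy => /entry_off_block ->. Qed.

Lemma entry_inj a b : (forall x y, entry a x y = entry b x y) -> a = b.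
Proof.
move=> ab; apply/ffunP => p; have := ab (val p).1 (val p).2.
by rewrite /entry -surjective_pairing valK.
Qed.

Lemma entryD a b x y : entry (a + b) x y = entry a x y + entry b x y.
Proof. by rewrite /entry; case: insubP => [p _ _|_]; rewrite ?addr0 // ffunE. Qed.

Lemma entryZ (k : R[i]) a x y : entry (k *: a) x y = k * entry a x y.
Proof. by rewrite /entry; case: insubP => [p _ _|_]; rewrite ?mulr0 // ffunE. Qed.

Lemma entryN a x y : entry (- a) x y = - entry a x y.
Proof. by rewrite -scaleN1r entryZ mulN1r. Qed.

Lemma entry0 x y : entry 0 x y = 0.
Proof. by rewrite -[0](scale0r 0) entryZ mul0r. Qed.

Lemma entry_sum I (s : seq I) (F : I -> D) x y :
  entry (\sum_(i <- s) F i) x y = \sum_(i <- s) entry (F i) x y.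
Proof.
elim: s => [|i s IHs]; first by rewrite !big_nil entry0.
by rewrite !big_cons entryD IHs.
Qed.

Definition bmul a b : D := of_entries (fun x z => \sum_y entry a x y * entry b y z).

Definition bstar a : D := of_entries (fun x y => Num.conj (entry a y x)).

Lemma entryM a b x z : entry (bmul a b) x z = \sum_y entry a x y * entry b y z.
Proof.
rewrite entry_of_entries; case: ifPn => // /negP xz; rewrite big1 // => y _.
have [axy|axy] := eqVneq (entry a x y) 0; first by rewrite axy mul0r.
rewrite (@entry_off_block b) ?mulr0 // -(entry_neq0 axy).
exact/negP.
Qed.

Lemma entryS a x y : entry (bstar a) x y = Num.conj (entry a y x).
Proof.
rewrite entry_of_entries; case: ifPn => // xy.
by rewrite entry_off_block ?conjC0 // eq_sym.
Qed.

Fact bmulA : associative bmul.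
Proof.
move=> a b c; apply: entry_inj => x t; rewrite !entryM.
under eq_bigr do rewrite entryM mulr_sumr.
rewrite exchange_big; apply: eq_bigr => z _; rewrite entryM mulr_suml.
by apply: eq_bigr => y _; rewrite mulrA.
Qed.

Fact bmulDl : left_distributive bmul +%R.
Proof.
move=> a b c; apply: entry_inj => x z; rewrite entryD !entryM -big_split.
by apply: eq_bigr => y _; rewrite entryD mulrDl.
Qed.

Fact bmulDr : right_distributive bmul +%R.
Proof.
move=> a b c; apply: entry_inj => x z; rewrite entryD !entryM -big_split.
by apply: eq_bigr => y _; rewrite entryD mulrDr.
Qed.

Fact bscaleAl (k : R[i]) a b : k *: bmul a b = bmul (k *: a) b.
Proof.
apply: entry_inj => x z; rewrite entryZ !entryM mulr_sumr.
by apply: eq_bigr => y _; rewrite entryZ mulrA.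
Qed.

Fact bscaleAr (k : R[i]) a b : k *: bmul a b = bmul a (k *: b).
Proof.
apply: entry_inj => x z; rewrite entryZ !entryM mulr_sumr.
by apply: eq_bigr => y _; rewrite entryZ mulrCA.
Qed.

Fact bstarK : involutive bstar.
Proof. by move=> a; apply: entry_inj => x y; rewrite !entryS conjCK. Qed.

Fact bstarD : {morph bstar : a b / a + b}.
Proof.
by move=> a b; apply: entry_inj => x y; rewrite entryD !entryS entryD rmorphD.
Qed.

Fact bstarZ (k : R[i]) a : bstar (k *: a) = Num.conj k *: bstar a.
Proof.
by apply: entry_inj => x y; rewrite entryZ !entryS entryZ rmorphM.
Qed.

Fact bstarM a b : bstar (bmul a b) = bmul (bstar b) (bstar a).
Proof.
apply: entry_inj => x z; rewrite entryS !entryM rmorph_sum.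
by apply: eq_bigr => y _; rewrite !entryS rmorphM mulrC.
Qed.

Definition act a u x : R[i] := \sum_y entry a x y * u y.

(** The operator norm of a block diagonal matrix is the maximum over its blocks, so it can be tested
    on vectors supported in one block. Rank one operators built from such vectors are again block
    diagonal, as [compress_to_munit] requires. *)
Definition in_one_block u : Prop := forall x y, u x != 0 -> u y != 0 -> r x = r y.

Lemma act_in_one_block a u : in_one_block u -> in_one_block (act a u).
Proof.
have ex x : act a u x != 0 -> exists2 y, r x = r y & u y != 0.
  move=> /sum_neq0[y]; rewrite mulf_eq0 negb_or => /andP[axy uy].
  by exists y => //; exact: entry_neq0 axy.
by move=> ub x y /ex[x' -> ux] /ex[y' -> uy]; exact: ub.
Qed.

Lemma actM a b u x : act (bmul a b) u x = act a (act b u) x.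
Proof.
rewrite /act; under eq_bigr do rewrite entryM mulr_suml.
rewrite exchange_big; apply: eq_bigr => y _; rewrite mulr_sumr.
by apply: eq_bigr => z _; rewrite mulrA.
Qed.

Lemma act_adjoint a u v :
  \sum_x Num.conj (act a u x) * v x = \sum_x Num.conj (u x) * act (bstar a) v x.
Proof.
rewrite /act; under eq_bigr do rewrite rmorph_sum mulr_suml.
rewrite exchange_big; apply: eq_bigr => y _; rewrite mulr_sumr.
by apply: eq_bigr => x _; rewrite entryS rmorphM mulrAC mulrC.
Qed.

Definition unit_values a : set R := [set t | exists u,
  [/\ in_one_block u, l2norm u <= 1 & t = l2norm (act a u)]].

Definition opnorm a : R := sup (unit_values a).

Lemma unit_values_ubound a :
  ubound (unit_values a) (\sum_x \sum_y cabs (entry a x y)).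
Proof.
move=> _ [u [_ u1 ->]]; rewrite (le_trans (l2norm_le_sum _)) // ler_sum // => x _.
rewrite (le_trans (cabs_sum _ _)) // ler_sum // => y _.
by rewrite cabsM ler_piMr ?cabs_ge0 // (le_trans (cabs_le_l2norm _ _)).
Qed.

Lemma unit_values0 a : unit_values a 0.
Proof.
exists (fun=> 0); split; first by move=> x y /eqP.
  by rewrite l2norm0.
rewrite -[LHS](l2norm0 R X); congr l2norm; apply/funext => x.
by rewrite /act big1 // => y _; rewrite mulr0.
Qed.

Lemma opnorm_le_sum a : opnorm a <= \sum_x \sum_y cabs (entry a x y).
Proof. by apply: ge_sup; [exists 0; exact: unit_values0|exact: unit_values_ubound]. Qed.

Lemma opnorm_ge0 a : 0 <= opnorm a.
Proof.
apply: ub_le_sup (unit_values0 a).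
by exists (\sum_x \sum_y cabs (entry a x y)); exact: unit_values_ubound.
Qed.

Lemma le_opnorm1 a u : in_one_block u -> l2norm u <= 1 ->
  l2norm (act a u) <= opnorm a.
Proof.
move=> ub u1; apply: ub_le_sup; last by exists u.
by exists (\sum_x \sum_y cabs (entry a x y)); exact: unit_values_ubound.
Qed.

Lemma le_opnorm a u : in_one_block u -> l2norm (act a u) <= opnorm a * l2norm u.
Proof.
move=> ub; have [u0|u0] := eqVneq (l2norm u) 0.
  rewrite u0 mulr0 le_eqVlt; apply/orP; left; apply/eqP.
  rewrite -[RHS](l2norm0 R X); congr l2norm; apply/funext => x.
  by rewrite /act big1 // => y _; rewrite (l2norm_eq0 _ u0) mulr0.
have u_gt0 : 0 < l2norm u by rewrite lt_neqAle eq_sym u0 l2norm_ge0.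
pose k : R[i] := (l2norm u)^-1%:C%C.
have kE : cabs k = (l2norm u)^-1 by rewrite cabsR // invr_ge0 ltW.
rewrite -ler_pdivrMr // mulrC -kE -l2normZ.
have -> : (fun x => k * act a u x) = act a (fun x => k * u x).
  apply/funext => x; rewrite /act mulr_sumr; apply: eq_bigr => y _.
  by rewrite mulrCA.
apply: le_opnorm1; last by rewrite l2normZ kE mulVf.
by move=> x y; rewrite !mulf_eq0 !negb_or => /andP[_ ux] /andP[_ uy]; exact: ub.
Qed.

Lemma opnorm_le a C : (forall u, in_one_block u -> l2norm u <= 1 ->
  l2norm (act a u) <= C) -> opnorm a <= C.
Proof.
move=> aC; apply: ge_sup; first by exists 0; exact: unit_values0.
by move=> _ [u [ub u1 ->]]; exact: aC.
Qed.

Lemma entry_le_opnorm a x y : cabs (entry a x y) <= opnorm a.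
Proof.
pose u z : R[i] := (z == y)%:R.
have au : act a u x = entry a x y.
  rewrite /act (bigD1 y) //= big1 ?addr0 /u ?eqxx ?mulr1 // => z /negbTE ->.
  by rewrite mulr0.
rewrite -au (le_trans (cabs_le_l2norm _ x)) //; apply: le_opnorm1.
  by move=> z t; rewrite /u !pnatr_eq0 !eqb0 !negbK => /eqP -> /eqP ->.
rewrite (le_trans (l2norm_le_sum _)) // (bigD1 y) //= big1 /u ?eqxx ?cabs1 ?addr0 //.
by move=> z /negbTE ->; rewrite cabs0.
Qed.

Fact opnormD a b : opnorm (a + b) <= opnorm a + opnorm b.
Proof.
apply: opnorm_le => u ub u1.
have -> : act (a + b) u = fun x => act a u x + act b u x.
  apply/funext => x; rewrite /act -big_split; apply: eq_bigr => y _.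
  by rewrite entryD mulrDl.
by rewrite (le_trans (l2normD _ _)) // lerD ?le_opnorm1.
Qed.

Lemma opnormZ_le (k : R[i]) a : opnorm (k *: a) <= cabs k * opnorm a.
Proof.
apply: opnorm_le => u ub u1.
have -> : act (k *: a) u = fun x => k * act a u x.
  apply/funext => x; rewrite /act mulr_sumr; apply: eq_bigr => y _.
  by rewrite entryZ mulrA.
by rewrite l2normZ ler_wpM2l ?cabs_ge0 // le_opnorm1.
Qed.

Fact opnorm_eq0 a : opnorm a = 0 -> a = 0.
Proof.
move=> a0; apply: entry_inj => x y; rewrite entry0; apply: cabs_eq0.
by apply/eqP; rewrite eq_le cabs_ge0 andbT -a0 entry_le_opnorm.
Qed.

Fact opnormZ (k : R[i]) a : opnorm (k *: a) = cabs k * opnorm a.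
Proof.
apply/eqP; rewrite eq_le opnormZ_le /=.
have [->|k0] := eqVneq k 0; first by rewrite cabs0 mul0r opnorm_ge0.
have ck : 0 < cabs k.
  rewrite lt_neqAle cabs_ge0 andbT eq_sym; apply: contra_neq k0.
  exact: cabs_eq0.
have := opnormZ_le k^-1 (k *: a); rewrite scalerA mulVf // scale1r.
move=> /(ler_wpM2l (ltW ck)) /le_trans; apply.
by rewrite mulrA -cabsM mulfV // cabs1 mul1r.
Qed.

Fact opnorm_complete (u : nat -> D) :
  cauchy_for opnorm u -> exists a, cvg_for opnorm u a.
Proof.
move=> uc.
have lim_xy (p : X * X) : exists l : R[i],
    cvg_for (@cabs R) (fun n => entry (u n) p.1 p.2) l.
  apply: complex_cauchy_cvg => e /uc[N NP]; exists N => m n Nm Nn.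
  by rewrite -entryN -entryD (le_trans (entry_le_opnorm _ _ _)) ?NP.
have [l lP] := choice lim_xy; pose a := of_entries (fun x y => l (x, y)).
exists a => e e0; pose K : R := (#|X| * #|X|)%:R + 1.
have K0 : 0 < K by rewrite ltr_wpDl.
have [N NP] : exists N, forall n, (N <= n)%N -> forall p : X * X,
    cabs (entry (u n) p.1 p.2 - l p) <= e / K.
  have : \forall n \near \oo, forall p : X * X,
      cabs (entry (u n) p.1 p.2 - l p) <= e / K.
    apply: filter_forall => p; have [N NP] := lP p _ (divr_gt0 e0 K0).
    by exists N.
  by move=> [N _ NP]; exists N => n Nn; exact: NP.
exists N => n Nn; rewrite (le_trans (opnorm_le_sum _)) //.
apply: (@le_trans _ _ (\sum_(x : X) \sum_(y : X) e / K)).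
  rewrite ler_sum // => x _; rewrite ler_sum // => y _.
  rewrite entryD entryN entry_of_entries; case: ifPn => [_|rxy].
    exact: (NP _ Nn (x, y)).
  by rewrite entry_off_block // subr0 cabs0 divr_ge0 ?ltW.
rewrite !sumr_const -mulrnA -mulr_natr mulrAC ler_pdivrMr //.
by rewrite ler_wpM2l ?ltW // ltrDl.
Qed.

HB.instance Definition _ := Lmodule_isRealNormedComplete.Build R D
  opnormD opnormZ opnorm_eq0 opnorm_complete.

Lemma blocks_normE (a : D) : `|a| = (opnorm a)%:C%C.
Proof. by []. Qed.

Lemma opnormM a b : opnorm (bmul a b) <= opnorm a * opnorm b.
Proof.
apply: opnorm_le => u ub u1.
have -> : act (bmul a b) u = act a (act b u) by apply/funext => x; exact: actM.
rewrite (le_trans (le_opnorm a (act_in_one_block ub))) //.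
by rewrite ler_wpM2l ?opnorm_ge0 // le_opnorm1.
Qed.

(** Moving [a] to the other side of the inner product, [|a u|^2] becomes the product of [u] with
    [bstar a] applied to [a u], to which the Cauchy-Schwarz inequality applies. *)
Lemma opnorm_sqr_le a : opnorm a ^+ 2 <= opnorm (bmul (bstar a) a).
Proof.
rewrite -[leRHS]sqr_sqrtr ?opnorm_ge0 // ler_sqr ?nnegrE ?opnorm_ge0 ?sqrtr_ge0 //.
apply: opnorm_le => u ub u1.
rewrite -[leLHS]ger0_norm ?l2norm_ge0 // -sqrtr_sqr ler_wsqrtr //.
rewrite -[leLHS]cabsR ?sqr_ge0 // l2norm_sqrC act_adjoint.
under eq_bigr do rewrite -actM.
rewrite (le_trans (cauchy_schwarz_l2norm _ _)) //.
rewrite (@le_trans _ _ (1 * l2norm (act (bmul (bstar a) a) u))) //.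
  by rewrite ler_wpM2r ?l2norm_ge0.
by rewrite mul1r le_opnorm1.
Qed.

Lemma opnormS a : opnorm (bstar a) = opnorm a.
Proof.
suff le_star b : opnorm b <= opnorm (bstar b).
  by apply/eqP; rewrite eq_le -{2}[a]bstarK !le_star.
have [b0|b0] := eqVneq (opnorm b) 0; first by rewrite b0 opnorm_ge0.
have b_gt0 : 0 < opnorm b by rewrite lt_neqAle eq_sym b0 opnorm_ge0.
rewrite -(ler_pM2r b_gt0) -expr2 (le_trans (opnorm_sqr_le b)) //.
exact: opnormM.
Qed.

Fact normM a b : `|bmul a b| <= `|a| * `|b|.
Proof. by rewrite !blocks_normE -real_complexM lecR opnormM. Qed.

Fact norm_star_mul a : `|bmul (bstar a) a| = `|a| ^+ 2.
Proof.
rewrite !blocks_normE -real_complexX; congr (_%:C%C).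
by apply/eqP; rewrite eq_le opnorm_sqr_le andbT (le_trans (opnormM _ _)) // opnormS expr2.
Qed.

HB.instance Definition _ := CompleteNormedModule_isCStarAlgebra.Build R D
  bmulA bmulDl bmulDr bscaleAl bscaleAr normM bstarK bstarD bstarZ bstarM
  norm_star_mul.

Lemma blocks_rnormE (a : D) : rnorm a = opnorm a.
Proof. by []. Qed.

Lemma blocks_finite_dimensional : finite_dimensional D.
Proof.
exists #|{: pair_in_block}|; constructor.
exists (fun a : D => \row_i (a : {ffun _ -> _}) (enum_val i)).
  by move=> k a b; apply/rowP => i; rewrite !mxE !ffunE.
exists (fun v : 'rV[R[i]]_#|{: pair_in_block}| => [ffun p => v ord0 (enum_rank p)] : D).
  by move=> a; apply/ffunP => p; rewrite ffunE mxE enum_rankK.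
by move=> v; apply/rowP => i; rewrite mxE ffunE enum_valK.
Qed.

End Blocks.

(** * Inclusions of path algebras *)

Section PathExtension.
Variables (R : realType) (X X' : finType) (V V' : eqType) (r : X -> V) (r' : X' -> V').
(** A path of the next level extends its parent by one edge, or is new if [par] is [None]. An
    extended path is determined by its parent and its end; whether a path extends to a given vertex
    depends only on its own end; and every path extends. *)
Variable par : X' -> option X.
Hypothesis par_inj : forall x' y', r' x' = r' y' -> par x' = par y' ->
  par x' -> x' = y'.
Hypothesis par_lift : forall x' x y, par x' = Some x -> r x = r y ->
  exists2 y', par y' = Some y & r' y' = r' x'.
Hypothesis par_surj : forall x, exists x', par x' = Some x.
Implicit Types (a b : blocks R r).

(** The matrix acts on the parent and keeps the last vertex; rows and columns of new paths are 0. *)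
Definition extend a : blocks R r' := of_entries r' (fun x' y' =>
  if par x' is Some x then if par y' is Some y then entry a x y else 0 else 0).

Lemma entry_extend a x' y' x y : par x' = Some x -> par y' = Some y ->
  r' x' = r' y' -> entry (extend a) x' y' = entry a x y.
Proof. by move=> px py rxy; rewrite entry_of_entries px py rxy eqxx. Qed.

Lemma entry_extend_neq0 a x' y' : entry (extend a) x' y' != 0 ->
  exists x y, [/\ par x' = Some x, par y' = Some y, r' x' = r' y' &
    entry (extend a) x' y' = entry a x y].
Proof.
rewrite entry_of_entries; case: (r' x' =P r' y') => [rxy|_]; last by rewrite eqxx.
case: (par x') => [x|]; last by rewrite eqxx.
case: (par y') => [y|]; last by rewrite eqxx.
by exists x, y.
Qed.

Lemma extend_hom : is_star_hom extend.
Proof.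
split=> [k a b|a b|a]; apply: entry_inj => x' z'.
- rewrite entryD entryZ !entry_of_entries.
  case: ifP => _; last by rewrite mulr0 addr0.
  case: (par x') => [x|]; last by rewrite mulr0 addr0.
  case: (par z') => [z|]; last by rewrite mulr0 addr0.
  by rewrite entryD entryZ.
- rewrite entryM entry_of_entries; case: eqP => [rxz|/eqP rxz]; last first.
    by rewrite -entryM entry_off_block.
  case px : (par x') => [x|]; last first.
    rewrite big1 // => y' _; rewrite entry_of_entries px.
    by case: ifP; rewrite mul0r.
  case pz : (par z') => [z|]; last first.
    rewrite big1 // => y' _; rewrite [X in _ * X]entry_of_entries pz.
    by case: (par y') => [y|]; case: ifP; rewrite mulr0.
  rewrite entryM.
  (* For fixed [y'] at most one [y] is its parent. Conversely, if [entry a x y] is nonzero, exactly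
     one [y'] ending with [x'] has the parent [y]: it exists by [par_lift] and is unique by
     [par_inj]. *)
  transitivity (\sum_y' \sum_y if (par y' == Some y) && (r' x' == r' y')
      then entry a x y * entry b y z else 0); last first.
    apply: eq_bigr => y' _; rewrite !entry_of_entries px pz -rxz eq_sym.
    case: (r' y' == r' x'); last by rewrite mul0r big1 // => y _; rewrite andbF.
    case py : (par y') => [y|]; last by rewrite mul0r big1.
    rewrite (bigD1 y) //= !eqxx /= big1 ?addr0 // => y1 /negbTE y1y.
    by rewrite andbT; case: eqP => // -[/esym/eqP]; rewrite y1y.
  rewrite exchange_big; apply: eq_bigr => y _ /=.
  have [axy|axy] := eqVneq (entry a x y) 0.
    by rewrite axy mul0r big1 // => y' _; case: ifP.
  have [y' py ryx] := par_lift px (entry_neq0 axy).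
  rewrite (bigD1 y') //= py ryx !eqxx /= big1 ?addr0 // => y1 y1y.
  case: andP => // -[/eqP py1 /eqP rxy1]; case/eqP: y1y.
  by apply: par_inj; rewrite ?py1 ?py // ryx.
- rewrite entryS !entry_of_entries eq_sym; case: ifP => _; last by rewrite conjC0.
  case: (par x') => [x|]; last by case: (par z') => [z|]; rewrite conjC0.
  by case: (par z') => [z|]; rewrite ?conjC0 // entryS.
Qed.

Lemma entry_extend_surj a x y : r x = r y ->
  exists x' y', entry (extend a) x' y' = entry a x y.
Proof.
move=> rxy; have [x' px] := par_surj x; have [y' py ryx] := par_lift px rxy.
by exists x', y'; exact: entry_extend.
Qed.

(** Every entry of [a] within a block reappears in [extend a], so the norm of [a] is at most [|X|^2]
    times that of its image; [le_of_square_le] removes this constant. The other inequality is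
    contractivity. *)
Lemma extend_iso a : rnorm (extend a) = rnorm a.
Proof.
apply/eqP; rewrite eq_le (star_hom_contractive extend_hom) /=.
pose sq a := cmul (cstar a) a.
apply: (@le_of_square_le R _ sq (@rnorm R _) (fun a => rnorm (extend a)) (#|X| * #|X|)%:R).
- by move=> b; exact: rnorm_ge0.
- by move=> b; exact: rnorm_cstar_mul.
- by move=> b; rewrite /sq (star_homM extend_hom) (star_homS extend_hom) rnorm_cstar_mul.
move=> b; rewrite !blocks_rnormE (le_trans (opnorm_le_sum _)) //.
apply: (@le_trans _ _ (\sum_(x : X) \sum_(y : X) opnorm (extend b))).
  rewrite ler_sum // => x _; rewrite ler_sum // => y _.
  have [rxy|rxy] := eqVneq (r x) (r y); last first.
    by rewrite entry_off_block // cabs0 opnorm_ge0.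
  by have [x' [y' <-]] := entry_extend_surj b rxy; exact: entry_le_opnorm.
by rewrite [leRHS]mulr_natl !sumr_const -mulrnA.
Qed.

End PathExtension.

(** * Prime refinements in distributive algebraic lattices *)

Section AlgebraicLattice.
Local Open Scope order_scope.
Variables (d : Order.disp_t) (L : distrLatticeType d).
Hypothesis hL : algebraic_lattice L.
Implicit Types (a b c : L) (X : set L) (s : seq L).

Definition lsup X : L := sval (cid (hL.1 X).1).

Lemma lsupP X : supremums X (lsup X).
Proof. exact: svalP (cid (hL.1 X).1). Qed.

Lemma lsup_leP X b : lsup X <= b <-> forall x, X x -> x <= b.
Proof.
have [ub lb] := lsupP X; split=> [Xb x Xx|]; last exact: lb.
exact: le_trans (ub _ Xx) Xb.
Qed.

Lemma le_lsup X x : X x -> x <= lsup X.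
Proof. by move=> Xx; case: (lsupP X) => ub _; exact: ub. Qed.

Definition lbot : L := lsup set0.

Lemma lbot_le b : lbot <= b. Proof. by apply/lsup_leP. Qed.

Definition fsup s : L := foldr Order.join lbot s.

Lemma fsup_leP s b : reflect {in s, forall x, x <= b} (fsup s <= b).
Proof.
apply: (iffP idP); elim: s => [|a s IHs] //= sb.
- by move: sb; rewrite leUx => /andP[ab /IHs sb] x /predU1P[->//|/sb].
- exact: lbot_le.
- rewrite leUx sb ?mem_head //= IHs // => x xs.
  by apply: sb; rewrite inE xs orbT.
Qed.

Lemma le_fsup s x : x \in s -> x <= fsup s.
Proof. by move=> xs; have /fsup_leP := lexx (fsup s); exact. Qed.

Lemma compact_le_fsup a X : compact_element a -> a <= lsup X ->
  exists s, (forall x, x \in s -> X x) /\ a <= fsup s.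
Proof.
move=> /(_ _ _ (lsupP X))/[apply] -[Y [/finite_seqP[s Ys] YX [t [_ tlb] at_]]].
exists s; split=> [x xs|]; first by apply: YX; rewrite Ys.
apply: le_trans at_ _; apply: tlb => y; rewrite Ys; exact: le_fsup.
Qed.

Lemma compact_lbot : compact_element lbot.
Proof.
move=> X u _ _; exists set0; split=> //.
by exists lbot; [exact: lsupP|exact: lexx].
Qed.

Lemma compact_join a b : compact_element a -> compact_element b ->
  compact_element (a `|` b).
Proof.
move=> ac bc X u Xu; rewrite leUx => /andP[/(ac _ _ Xu) aY /(bc _ _ Xu) bY].
have [Y [Yfin YX [t [_ tlb] at_]]] := aY; have [Z [Zfin ZX [v [_ vlb] bv]]] := bY.
exists (Y `|` Z)%classic; split; first by rewrite finite_setU.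
  by move=> x [/YX|/ZX].
exists (lsup (Y `|` Z)%classic); first exact: lsupP.
rewrite leUx (le_trans at_) ?(le_trans bv) //.
- by apply: vlb => z Zz; apply: le_lsup; right.
- by apply: tlb => z Zz; apply: le_lsup; left.
Qed.

Lemma compact_fsup s : (forall x, x \in s -> compact_element x) ->
  compact_element (fsup s).
Proof.
elim: s => [|a s IHs] sc /=; first exact: compact_lbot.
apply: compact_join; first by apply: sc; exact: mem_head.
by apply: IHs => x xs; apply: sc; rewrite inE xs orbT.
Qed.

Lemma compact_lsup_le a b :
  (forall c, compact_element c -> c <= a -> c <= b) -> a <= b.
Proof.
move=> ab; have [X Xc [ub lb]] := hL.2 a.
by apply: lb => x Xx; apply: ab; [exact: Xc|exact: ub].
Qed.

Section Refinement.
Variables (W : finType) (t : W -> L).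
Hypothesis tc : forall w, compact_element (t w).
Implicit Types (F U : {set W}) (w : W).

Definition tsup U : L := lsup [set t u | u in [set` U]].

(** For [U] empty the condition excludes the bottom as a label over [F]. The empty set is prime. *)
Definition prime_set F : Prop := forall w U, w \in F -> t w <= tsup U ->
  exists2 u, u \in U & u \in F.

Definition tinf F : L := lsup [set b | forall w, w \in F -> b <= t w].

Lemma tinf_le F w : w \in F -> tinf F <= t w.
Proof. by move=> wF; apply/lsup_leP => b; exact. Qed.

Lemma le_tinf F b : (forall w, w \in F -> b <= t w) -> b <= tinf F.
Proof. by move=> bF; exact: le_lsup. Qed.

(** Distributivity enters here: [a] is its own meet with the join of the labels of [U], hence the
    join of the meets with the single labels. *)
Lemma meet_tsup_le U a b : a <= tsup U -> (forall u, u \in U -> a `&` t u <= b) ->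
  a <= b.
Proof.
move=> aU Ub.
have {}aU : a <= fsup [seq t u | u <- enum U].
  apply: le_trans aU _; apply/lsup_leP => _ [u /= uU <-].
  by apply: le_fsup; apply: map_f; rewrite mem_enum.
have {}Ub u : u \in enum U -> a `&` t u <= b by rewrite mem_enum; exact: Ub.
rewrite -(meet_idPl aU) {aU}; elim: (enum U) Ub => [|u s IHs] Ub /=.
  by rewrite (le_trans (leIr _ _)) // lbot_le.
rewrite meetUr leUx Ub ?mem_head //= IHs // => v vs.
by apply: Ub; rewrite inE vs orbT.
Qed.

(** Induction on the size of the complement of [F]. If primality fails for [w] and [U], then
    [tinf F <= t w <= tsup U], and [meet_tsup_le] reduces the claim to the larger sets [u |: F] with
    [u] in [U]. *)
Lemma tinf_le_of_prime F b :
  (forall G, prime_set G -> F \subset G -> tinf G <= b) -> tinf F <= b.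
Proof.
have [n] := ubnP #|~: F|; elim: n F => // n IHn F Fn Fb.
have [pF|npF] := pselect (prime_set F); first exact: Fb.
have [w [U [wF wU UF]]] : exists w U,
    [/\ w \in F, t w <= tsup U & forall u, u \in U -> u \notin F].
  apply: contrapT => H; apply: npF => w U wF wU; apply: contrapT => UF.
  apply: H; exists w, U; split => // u uU; apply/negP => uF.
  by apply: UF; exists u.
apply: (@meet_tsup_le U); first exact: le_trans (tinf_le wF) wU.
move=> u uU; apply: (@le_trans _ _ (tinf (u |: F))).
  apply: le_tinf => v; rewrite !inE => /predU1P[->|vF]; first exact: leIr.
  exact: le_trans (leIl _ _) (tinf_le vF).
apply: IHn.
  rewrite -ltnS; apply: leq_trans Fn; rewrite !ltnS; apply: proper_card.
  rewrite properE !finset.setCS finset.subsetUr /=; apply/fintype.subsetPn.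
  by exists u; [rewrite !inE eqxx|exact: UF].
move=> G pG FG; apply: Fb => //; apply: fintype.subset_trans FG; exact: finset.subsetUr.
Qed.

Lemma exists_prime_refinement : exists e : {set W} -> L,
  [/\ forall F, compact_element (e F),
      forall F w, w \in F -> e F <= t w,
      forall w b, (forall F, w \in F -> e F <= b) -> t w <= b
    & forall F, e F != lbot -> F != finset.set0 /\ prime_set F].
Proof.
(* By [tinf_le_of_prime] and algebraicity the supremum of [X w] is at least [t w]; compactness of
   [t w] then selects a finite list [s w]. *)
pose X w : set L := [set c | compact_element c /\
  exists F, [/\ prime_set F, w \in F & c <= tinf F]].
have Xs w : exists s, (forall x, x \in s -> X w x) /\ t w <= fsup s.
  apply: compact_le_fsup => //; apply: (@le_trans _ _ (tinf [set w]%SET)).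
    by apply: le_tinf => v /set1P ->.
  apply: tinf_le_of_prime => G pG wG; apply: compact_lsup_le => c cc cG.
  by apply: le_lsup; split=> //; exists G; split=> //; rewrite -finset.sub1set.
have [s sP] := choice Xs.
(* The lists of all [w] are pooled because [e F] has to depend on [F] alone. The empty set, although
   prime, gets the bottom, so that it does not become a vertex. *)
pose e F := if `[< prime_set F >] && (F != finset.set0) then
  fsup [seq c <- flatten [seq s w | w <- enum W] | c <= tinf F] else lbot.
exists e; split=> [F|F w wF|w b Fb|F]; rewrite /e.
- case: ifP => _; last exact: compact_lbot.
  apply: compact_fsup => c; rewrite mem_filter => /andP[_ /flatten_mapP[w _]].
  by move=> /(sP w).1 [].
- case: ifP => _; last exact: lbot_le.
  apply/fsup_leP => c; rewrite mem_filter => /andP[cF _].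
  exact: le_trans cF (tinf_le wF).
- apply: le_trans (sP w).2 _; apply/fsup_leP => c cs.
  have [_ [F [pF wF cF]]] := (sP w).1 _ cs.
  apply: le_trans (Fb F wF); rewrite /e; have -> /= : `[< prime_set F >] by apply/asboolP.
  have -> : F != finset.set0 by apply/set0Pn; exists w.
  apply: le_fsup; rewrite mem_filter cF; apply/flatten_mapP; exists w => //.
  by rewrite mem_enum.
- by case: ifP; rewrite ?eqxx // => /andP[/asboolP].
Qed.

End Refinement.

End AlgebraicLattice.

(** * The Bratteli diagram *)

Section Tower.
Variables (R : realType) (d : Order.disp_t) (L : distrLatticeType d).
Hypothesis hL : algebraic_lattice L.

(* A level of a Bratteli diagram: stX consists of the paths that end there, and
   str sends a path to its last vertex. *)
Record stage := Stage {
  stV : finType;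
  stX : finType;
  str : stX -> stV;
  stl : stV -> L;
  stl_compact : forall v, compact_element (stl v);
  stl_neq : forall v, stl v != lbot hL;
  str_surj : forall v, exists x, str x = v
}.

(** * One step of the diagram *)

Section NextStage.
Variables (S : stage) (b : L).
Hypothesis bc : compact_element b.

(* Before the step the vertex None, with label b, is added to the level; a
   vertex of the next level is a set of vertices, the set of its predecessors. *)
Definition next_label (w : option (stV S)) : L :=
  if w is Some v then stl v else b.

Lemma next_label_compact w : compact_element (next_label w).
Proof. by case: w => [v|//]; exact: stl_compact. Qed.

Definition prime_label : {set option (stV S)} -> L :=
  sval (cid (exists_prime_refinement hL next_label_compact)).

Lemma prime_labelP :
  [/\ forall F, compact_element (prime_label F),
      forall (F : {set _}) w, w \in F -> (prime_label F <= next_label w)%O,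
      forall w a, (forall F : {set _}, w \in F -> (prime_label F <= a)%O) ->
        (next_label w <= a)%O
    & forall F, prime_label F != lbot hL ->
        F != finset.set0 /\ prime_set hL next_label F].
Proof. exact: svalP (cid (exists_prime_refinement hL next_label_compact)). Qed.

Definition next_vertex : finType :=
  {F : {set option (stV S)} | prime_label F != lbot hL}.

(* A vertex whose only predecessor is None starts a path of its own. *)
Definition is_path (p : option (stX S) * next_vertex) : bool :=
  if p.1 is Some x then Some (str x) \in val p.2
  else [forall v, Some v \notin val p.2].

Definition next_path : finType := {p | is_path p}.

Definition parent (x : next_path) : option (stX S) := (val x).1.

Definition next_end (x : next_path) : next_vertex := (val x).2.

Lemma next_path_exists (x : stX S) (w : next_vertex) : Some (str x) \in val w ->
  exists2 x', parent x' = Some x & next_end x' = w.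
Proof.
move=> xw; pose p : option (stX S) * next_vertex := (Some x, w).
by exists (exist _ p xw : next_path).
Qed.

Lemma parent_edge x' x : parent x' = Some x -> Some (str x) \in val (next_end x').
Proof. by rewrite /parent /next_end; case: x' => -[[y|] w] //= yw [<-]. Qed.

(** A vertex is a nonempty set of predecessors; without old ones it contains [None]. *)
Lemma parent_none x' : parent x' = None ->
  None \in val (next_end x') /\ forall v, Some v \notin val (next_end x').
Proof.
rewrite /parent /next_end; case: x' => -[[y|] [F Fn]] //= /forallP noV _.
split=> //; have [_ _ _ /(_ _ Fn)[/set0Pn[[v vF|//] _]]] := prime_labelP.
by have := noV v; rewrite vF.
Qed.

Lemma next_end_surj (w : next_vertex) : exists x, next_end x = w.
Proof.
have [[v vw]|noV] := pselect (exists v, Some v \in val w).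
  have [x xv] := str_surj v; rewrite -xv in vw.
  by have [x' _ x'w] := next_path_exists vw; exists x'.
have wP : [forall v, Some v \notin val w].
  by apply/forallP => v; apply/negP => vw; apply: noV; exists v.
pose p : option (stX S) * next_vertex := (None, w).
by exists (exist _ p wP : next_path).
Qed.

Definition next_stage : stage := @Stage next_vertex next_path next_end
  (fun w => prime_label (val w))
  (fun w => let: And4 H _ _ _ := prime_labelP in H (val w))
  (fun w => valP w) next_end_surj.

Local Notation label := (@stl next_stage).

Lemma next_le v (w : next_vertex) : v \in val w -> (label w <= next_label v)%O.
Proof. by have [_ H _ _] := prime_labelP; exact: H. Qed.

(** With [next_le] this makes a label the join of the labels of its successors. Sets labelled by the
    bottom are not vertices, but they lie below every [a]. *)
Lemma le_of_next v (a : L) : (forall w : next_vertex, v \in val w -> (label w <= a)%O) ->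
  (next_label v <= a)%O.
Proof.
move=> wa; have [_ _ H _] := prime_labelP; apply: H => F vF.
have [->|Fn] := eqVneq (prime_label F) (lbot hL); first exact: lbot_le.
exact: (wa (exist _ F Fn)).
Qed.

(** Consequently, if the label of [v] is below the join of those of [U], the block of [v] is mapped
    into blocks that are reached from [U], and so lies in the ideal generated by [U]. *)
Lemma next_prime v (w : next_vertex) (U : {set stV S}) : v \in val w ->
  (next_label v <= tsup hL (@stl S) U)%O -> exists2 u, u \in U & Some u \in val w.
Proof.
move=> vw vU; have [_ _ _ /(_ _ (valP w))[_ pw]] := prime_labelP.
have [|u] := pw v (Some @: U) vw.
  apply: le_trans vU _; apply/lsup_leP => _ [u /= uU <-].
  by apply: le_lsup; exists (Some u) => //=; exact: imset_f.
by move=> /imsetP[u' u'U ->]; exists u'.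
Qed.

Lemma parent_inj x' y' : next_end x' = next_end y' -> parent x' = parent y' ->
  parent x' -> x' = y'.
Proof.
rewrite /parent /next_end => e1 e2 _; apply: val_inj.
by rewrite [val x']surjective_pairing e1 e2 -surjective_pairing.
Qed.

Lemma parent_lift x' (x y : stX S) : parent x' = Some x -> str x = str y ->
  exists2 y', parent y' = Some y & next_end y' = next_end x'.
Proof.
by move=> /parent_edge px rxy; apply: next_path_exists; rewrite -rxy.
Qed.

(** A vertex without successors would have the bottom as its label. *)
Lemma parent_surj (x : stX S) : exists x', parent x' = Some x.
Proof.
have [[w xw]|no] := pselect (exists w : next_vertex, Some (str x) \in val w).
  by have [x' px _] := next_path_exists xw; exists x'.
have /negP[] := stl_neq (str x); rewrite eq_le lbot_le andbT.
by apply: (@le_of_next (Some (str x))) => w xw; case: no; exists w.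
Qed.

End NextStage.

(** The diagram starts from the zero algebra; all vertices stem from the added elements [c n]. *)
Definition empty_stage : stage.
Proof. by exists void void (of_void void) (of_void L); case. Defined.

Variable c : nat -> L.
Hypothesis cc : forall n, compact_element (c n).

Fixpoint tower n : stage :=
  if n is n'.+1 then next_stage (tower n') (@cc n') else empty_stage.

Local Notation X n := (stX (tower n)).
Local Notation r n := (@str (tower n)).
Local Notation label := (@stl (tower _)).

Definition level n : cstarAlgType R := blocks R (r n).

Definition embed n : level n -> level n.+1 :=
  @extend R (X n) (X n.+1) _ _ (r n) (r n.+1) (@parent (tower n) _ (@cc n)).

Lemma embed_hom n : is_star_hom (@embed n).
Proof. by apply: extend_hom; [exact: parent_inj|exact: parent_lift]. Qed.

Lemma embed_iso n (a : level n) : rnorm (embed a) = rnorm a.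
Proof.
by apply: extend_iso; [exact: parent_inj|exact: parent_lift|exact: parent_surj].
Qed.

Definition tower_system : isometric_system R :=
  IsometricSystem embed_hom embed_iso.

End Tower.

(** * Matrix units and closed ideals *)

Section MatrixUnits.
Variables (R : realType) (X : finType) (V : eqType) (r : X -> V).
Local Notation D := (blocks R r).
Implicit Types (x y z : X) (a b : D).

Definition munit x y : D := of_entries r (fun z t => ((z == x) && (t == y))%:R).

Lemma entry_munit x y z t : r x = r y ->
  entry (munit x y) z t = ((z == x) && (t == y))%:R.
Proof.
move=> rxy; rewrite entry_of_entries; case: eqP => // rzt.
by case: eqP => //= zx; case: eqP => //= ty; case: rzt; rewrite zx ty.
Qed.

Lemma munit_mul_munit x y z t a : r x = r y -> r z = r t ->
  cmul (munit x y) (cmul a (munit z t)) = entry a y z *: munit x t.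
Proof.
move=> rxy rzt; apply: entry_inj => i j; rewrite entryZ entryM (bigD1 y) //=.
rewrite big1 ?addr0 => [|k /negbTE ky]; last first.
  by rewrite entry_munit // ky andbF mul0r.
rewrite entryM (bigD1 z) //= big1 ?addr0 => [|k /negbTE kz]; last first.
  by rewrite entry_munit // kz mulr0.
rewrite (entry_munit _ _ rxy) (entry_munit _ _ rzt) !eqxx andbT /=.
have [ryz|ryz] := eqVneq (r y) (r z); last first.
  by rewrite entry_off_block // mul0r mulr0 mul0r.
rewrite entry_munit ?rxy ?ryz //.
by case: (i == x); case: (j == t); rewrite ?mulr1 ?mul1r ?mulr0 ?mul0r.
Qed.

Lemma munit_mul x y z : r x = r y -> r y = r z ->
  cmul (munit x y) (munit y z) = munit x z.
Proof.
move=> rxy ryz; apply: entry_inj => i j; rewrite entryM (bigD1 y) //=.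
rewrite big1 ?addr0 => [|k /negbTE ky]; last first.
  by rewrite entry_munit // ky andbF mul0r.
rewrite !entry_munit ?rxy // !eqxx andbT /=.
by case: (i == x); rewrite ?mul1r ?mul0r.
Qed.

Lemma munit_star x : cstar (munit x x) = munit x x.
Proof.
apply: entry_inj => i j; rewrite entryS !entry_munit // conjC_nat.
by rewrite andbC.
Qed.

Lemma sum_munit a : a = \sum_x \sum_y entry a x y *: munit x y.
Proof.
apply: entry_inj => i j; rewrite entry_sum.
have e x y : entry (entry a x y *: munit x y) i j =
    if (x == i) && (y == j) then entry a i j else 0.
  rewrite entryZ; have [rxy|rxy] := eqVneq (r x) (r y); last first.
    rewrite entry_off_block // mul0r; case: andP => // -[/eqP xi /eqP yj].
    by rewrite entry_off_block // -xi -yj.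
  rewrite entry_munit // (eq_sym i) (eq_sym j).
  by case: (eqVneq x i) => [->|]; case: (eqVneq y j) => [->|]; rewrite /= ?mulr1 ?mulr0.
transitivity (\sum_x \sum_y if (x == i) && (y == j) then entry a i j else 0).
  by rewrite pair_bigA -big_mkcond (big_pred1 (i, j)).
apply: eq_bigr => x _; rewrite entry_sum; apply: eq_bigr => y _.
by rewrite e.
Qed.

Definition identity_blocks : D := of_entries r (fun x y => (x == y)%:R).

Lemma entry_identity x y : entry identity_blocks x y = (x == y)%:R.
Proof.
by rewrite entry_of_entries; have [->|_] := eqVneq x y; rewrite ?eqxx ?if_same.
Qed.

Lemma identity_blocks_mul a : cmul identity_blocks a = a /\ cmul a identity_blocks = a.
Proof.
split; apply: entry_inj => x y; rewrite entryM.
  rewrite (bigD1 x) //= big1 ?addr0 ?entry_identity ?eqxx ?mul1r // => z.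
  by rewrite entry_identity eq_sym => /negbTE ->; rewrite mul0r.
rewrite (bigD1 y) //= big1 ?addr0 ?entry_identity ?eqxx ?mulr1 // => z.
by rewrite entry_identity => /negbTE ->; rewrite mulr0.
Qed.

(* The witnesses are the rank one operators W = e_x0 (d u)^* and U = u e_x0^*. *)
Lemma compress_to_munit (d : D) (u : X -> R[i]) x0 :
  in_one_block r u -> l2norm u <= 1 -> act d u x0 != 0 ->
  exists W U : D, [/\ rnorm W <= l2norm (act d u), rnorm U <= 1 &
    cmul W (cmul d U) = (l2norm (act d u) ^+ 2)%:C%C *: munit x0 x0].
Proof.
set v := act d u => ub u1 v0.
have vb : in_one_block r v := act_in_one_block ub.
have ru y : u y != 0 -> r y = r x0.
  move=> uy; have [z] := sum_neq0 v0.
  by rewrite mulf_eq0 negb_or => /andP[/entry_neq0 -> uz]; exact: ub.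
pose U : D := of_entries r (fun y z => u y * (z == x0)%:R).
pose W : D := of_entries r (fun z x => (z == x0)%:R * Num.conj (v x)).
have UE y z : entry U y z = u y * (z == x0)%:R.
  rewrite entry_of_entries; case: eqP => // ryz.
  have [uy|uy] := eqVneq (u y) 0; first by rewrite uy mul0r.
  by case: eqP => [zx|]; [case: ryz; rewrite zx ru|rewrite mulr0].
have WE z x : entry W z x = (z == x0)%:R * Num.conj (v x).
  rewrite entry_of_entries; case: eqP => // rzx.
  have [vx|vx] := eqVneq (v x) 0; first by rewrite vx conjC0 mulr0.
  by case: eqP => [zx|]; [case: rzx; rewrite zx; exact: vb|rewrite mul0r].
exists W, U; split.
- rewrite blocks_rnormE; apply: opnorm_le => w wb w1.
  have -> : act W w = fun z => (\sum_x Num.conj (v x) * w x) * (z == x0)%:R.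
    apply/funext => z; rewrite /act mulr_suml; apply: eq_bigr => x _.
    by rewrite WE mulrC mulrA mulrAC [w x * _]mulrC.
  rewrite l2normZ (le_trans (ler_wpM2l (cabs_ge0 _) (l2norm_le_sum _))) //.
  have -> : \sum_x cabs (x == x0)%:R = 1 :> R.
    rewrite (bigD1 x0) //= eqxx cabs1 big1 ?addr0 // => z /negbTE ->.
    exact: cabs0.
  rewrite mulr1 (le_trans (cauchy_schwarz_l2norm _ _)) //.
  by rewrite ler_piMr ?l2norm_ge0.
- rewrite blocks_rnormE; apply: opnorm_le => w wb w1.
  have -> : act U w = fun y => w x0 * u y.
    apply/funext => y; rewrite /act (bigD1 x0) //= big1 => [|z /negbTE zx].
      by rewrite UE eqxx mulr1 addr0 mulrC.
    by rewrite UE zx mulr0 mul0r.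
  rewrite l2normZ mulr_ile1 ?cabs_ge0 ?l2norm_ge0 //.
  exact: le_trans (cabs_le_l2norm _ _) w1.
- apply: entry_inj => z t; rewrite entryZ entry_munit // entryM l2norm_sqrC.
  rewrite mulr_suml; apply: eq_bigr => x _; rewrite WE.
  have -> : entry (cmul d U) x t = v x * (t == x0)%:R.
    rewrite entryM /v /act mulr_suml; apply: eq_bigr => y _.
    by rewrite UE mulrA.
  by case: (z == x0); case: (t == x0); rewrite ?mul0r ?mulr0 ?mul1r ?mulr1.
Qed.

End MatrixUnits.

Section ClosedIdeals.
Variables (R : realType) (A : cstarAlgType R) (I : set A).
Hypothesis Iid : is_closed_ideal I.
Implicit Types x y q b : A.

Lemma closed_idealP x : (forall e, 0 < e -> exists2 y, I y & rnorm (x - y) <= e) -> I x.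
Proof. by case: Iid => /closed_rnormP + _ _ _; exact. Qed.

Lemma closed_ideal0 : I 0. Proof. by case: Iid. Qed.

Lemma closed_idealD x y : I x -> I y -> I (x + y).
Proof.
by move=> Ix Iy; rewrite -[x]scale1r; case: Iid => _ _ + _; exact.
Qed.

Lemma closed_idealZ (k : R[i]) x : I x -> I (k *: x).
Proof.
move=> Ix; rewrite -[k *: x]addr0; case: Iid => _ I0 + _; exact.
Qed.

Lemma closed_idealMl x y : I y -> I (cmul x y).
Proof. by move=> Iy; case: Iid => _ _ _ /(_ x y Iy)[]. Qed.

Lemma closed_idealMr x y : I y -> I (cmul y x).
Proof. by move=> Iy; case: Iid => _ _ _ /(_ x y Iy)[]. Qed.

Lemma closed_ideal_sum J (s : seq J) (F : J -> A) :
  (forall j, I (F j)) -> I (\sum_(j <- s) F j).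
Proof.
move=> IF; elim: s => [|j s IHs]; first by rewrite big_nil; exact: closed_ideal0.
by rewrite big_cons; exact: closed_idealD.
Qed.

Lemma rnorm_projection_le1 q : cstar q = q -> cmul q q = q -> rnorm q <= 1.
Proof.
move=> qs qq; have := rnorm_cstar_mul q; rewrite qs qq.
have [->|q0] := eqVneq (rnorm q) 0; first by [].
have q_gt0 : 0 < rnorm q by rewrite lt_neqAle eq_sym q0 rnorm_ge0.
by rewrite -(ler_pM2r q_gt0) mul1r -expr2 => <-.
Qed.

(* With t = q - q b q one has q - t^k in I and t^k --> 0. *)
Lemma closed_ideal_near_projection q b : cstar q = q -> cmul q q = q -> I b ->
  rnorm (q - b) < 1 -> I q.
Proof.
move=> qs qq Ib qb; have q1 := rnorm_projection_le1 qs qq.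
pose b' := cmul q (cmul b q); pose t := q - b'.
have Ib' : I b' by apply/closed_idealMl/closed_idealMr.
have tE : t = cmul q (cmul (q - b) q) by rewrite cmulBl cmulBr qq qq.
have t_le : rnorm t <= rnorm (q - b).
  rewrite tE (le_trans (rnorm_cmul _ _)) //.
  rewrite (le_trans (ler_pM (rnorm_ge0 _) (rnorm_ge0 _) q1 (rnorm_cmul _ _))) //.
  by rewrite mul1r ler_piMr ?rnorm_ge0.
have qt : cmul q t = t by rewrite tE !cmulA qq.
pose p k := iter k (fun x => cmul x t) t.
have Ip k : I (q - p k).
  elim: k => [|k IHk] /=; first by rewrite opprB addrC subrK.
  have -> : q - cmul (p k) t = b' + cmul (q - p k) t.
    by rewrite cmulBl qt addrA [b' + t]addrC subrK.
  by apply: closed_idealD => //; exact: closed_idealMr.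
have p_le k : rnorm (p k) <= rnorm t ^+ k.+1.
  elim: k => [|k IHk] /=; first by rewrite expr1.
  by rewrite (le_trans (rnorm_cmul _ _)) // exprSr ler_wpM2r ?rnorm_ge0.
apply: closed_idealP => e e0.
have t1 : `|rnorm t| < 1 by rewrite ger0_norm ?rnorm_ge0 // (le_lt_trans t_le).
have /cvgr0Pnorm_le/(_ _ e0)[N _ NP] := cvg_expr t1.
exists (q - p N); first exact: Ip.
rewrite opprB addrC subrK (le_trans (p_le N)) //.
have := NP N.+1 (leqnSn N); rewrite /= normrX ger0_norm ?rnorm_ge0 //.
Qed.

End ClosedIdeals.

(** * The lattice of closed ideals *)

Lemma rnorm_cmul_approx (R : realType) (A : cstarAlgType R) (a b : A)
    (e : R) : 0 < e -> exists2 t : R, 0 < t &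
  forall a' b' : A, rnorm (a - a') <= t -> rnorm (b - b') <= t ->
    rnorm (cmul a b - cmul a' b') <= e.
Proof.
move=> e0; pose K := rnorm a + rnorm b + 1.
have K0 : 0 < K by rewrite ltr_wpDl // addr_ge0 // rnorm_ge0.
(* The bound by 1 keeps the norm of [b'] below [rnorm b + 1]. *)
pose t := Num.min 1 (e / K); have t1 : t <= 1 by rewrite ge_min lexx.
have tK : t * K <= e by rewrite -ler_pdivlMr // ge_min lexx orbT.
have t0 : 0 < t by rewrite lt_min ltr01 divr_gt0.
exists t => // a' b' aa' bb'.
have -> : cmul a b - cmul a' b' = cmul a (b - b') + cmul (a - a') b'.
  by rewrite cmulBr cmulBl addrA subrK.
rewrite (le_trans (rnormD _ _)) //.
rewrite (le_trans (lerD (rnorm_cmul _ _) (rnorm_cmul _ _))) //.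
have b'1 : rnorm b' <= rnorm b + 1.
  rewrite -[b'](subrK b) addrC (le_trans (rnormD _ _)) // lerD //.
  by rewrite rnorm_distC (le_trans bb').
apply: le_trans tK.
have := ler_wpM2l (rnorm_ge0 a) bb'.
have := ler_pM (rnorm_ge0 _) (rnorm_ge0 _) aa' b'1.
rewrite /K; lra.
Qed.

Section IdealLattice.
Variables (R : realType) (d : Order.disp_t) (L : distrLatticeType d).
Hypothesis hL : algebraic_lattice L.
Variable c : nat -> L.
Hypothesis cc : forall n, compact_element (c n).

Local Notation St n := (tower hL cc n).
Local Notation X n := (stX (St n)).
Local Notation V n := (stV (St n)).
Local Notation r := (@str _ _ hL (St _)).
Local Notation label := (@stl _ _ hL (St _)).
Local Notation D n := (blocks R (@str _ _ hL (St n))).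
Local Notation sys := (tower_system R hL cc).
Local Notation f := (@embed R _ _ hL c cc _).
Local Notation sh k := (@shift R sys _ k).

(** The limit enters through these properties: it contains the levels isometrically and compatibly,
    and their union is dense. *)
Variables (A : cstarAlgType R) (phi : forall n, D n -> A).
Hypothesis phi_hom : forall n, is_star_hom (@phi n).
Hypothesis phi_rnorm : forall n (a : D n), rnorm (phi a) = rnorm a.
Hypothesis phi_embed : forall n (a : D n), phi (f a) = phi a.
Hypothesis phi_dense : forall (a : A) e, 0 < e ->
  exists n (b : D n), rnorm (a - phi b) <= e.

Lemma phiM n (a b : D n) : phi (cmul a b) = cmul (phi a) (phi b).
Proof. exact: (star_homM (phi_hom n)). Qed.

Lemma phiB n (a b : D n) : phi (a - b) = phi a - phi b.
Proof. exact: (star_homB (phi_hom n)). Qed.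

Lemma phiZ n (k : R[i]) (a : D n) : phi (k *: a) = k *: phi a.
Proof. exact: (star_homZ (phi_hom n)). Qed.

Lemma phi_sum n J (s : seq J) (F : J -> D n) :
  phi (\sum_(j <- s) F j) = \sum_(j <- s) phi (F j).
Proof. exact: (star_hom_sum (phi_hom n)). Qed.

Lemma phi_opnorm n (a : D n) : rnorm (phi a) = opnorm a.
Proof. exact: phi_rnorm. Qed.

Lemma phi_shift n k (a : D n) : phi (sh k a : D (k + n)%N) = phi a.
Proof. by elim: k => //= k <-; exact: phi_embed. Qed.

Lemma dense_from (a : A) e : 0 < e ->
  exists N, forall m, (N <= m)%N -> exists b : D m, rnorm (a - phi b) <= e.
Proof.
move=> /(phi_dense a)[N [b ab]]; exists N => m /subnK <-.
by exists (sh (m - N) b); rewrite phi_shift.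
Qed.

Definition below n (a : D n) (l : L) : Prop :=
  forall x y, entry a x y != 0 -> (label (r x) <= l)%O.

Lemma entry_embed n (a : D n) x y x' y' : parent x' = Some x ->
  parent y' = Some y -> next_end x' = next_end y' -> entry (f a) x' y' = entry a x y.
Proof. exact: entry_extend. Qed.

Lemma entry_embed_neq0 n (a : D n) x' y' : entry (f a) x' y' != 0 ->
  exists x y, [/\ parent x' = Some x, parent y' = Some y &
    entry (f a) x' y' = entry a x y].
Proof. by move=> /entry_extend_neq0[x [y [px py _ fa]]]; exists x, y. Qed.

(** A label is the join of the labels of the successors, so [below] does not depend on the level at
    which an element is viewed. *)
Lemma below_embed n (a : D n) l : below (f a) l <-> below a l.
Proof.
split=> [fal x y axy|al x' y' /[dup] faxy /entry_embed_neq0[x [y [px py faE]]]].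
  apply: (@le_of_next _ _ _ _ _ (@cc n) (Some (r x))) => w xw.
  have [x' px x'w] := next_path_exists xw.
  have yw : Some (r y) \in val w by rewrite -(entry_neq0 axy).
  have [y' py y'w] := next_path_exists yw.
  rewrite -x'w; apply: (fal x' y').
  by rewrite (entry_embed a px py) // x'w y'w.
apply: le_trans (al x y _); last by rewrite -faE.
exact: (next_le (parent_edge px)).
Qed.

Lemma below_shift n k (a : D n) l : below (sh k a : D (k + n)%N) l <-> below a l.
Proof. by elim: k => //= k <-; exact: below_embed. Qed.

Lemma below0 n l : below (0 : D n) l.
Proof. by move=> x y; rewrite entry0 eqxx. Qed.

Lemma belowP n (k : R[i]) (a b : D n) l : below a l -> below b l ->
  below (k *: a + b) l.
Proof.
move=> al bl x y; rewrite entryD entryZ.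
have [axy|axy] := eqVneq (entry a x y) 0; last by move=> _; exact: al axy.
have [bxy|bxy] := eqVneq (entry b x y) 0; last by move=> _; exact: bl bxy.
by rewrite axy bxy mulr0 addr0 eqxx.
Qed.

Lemma belowM n (a b : D n) l : below b l ->
  below (cmul a b) l /\ below (cmul b a) l.
Proof.
move=> bl; split=> x y; rewrite entryM => /sum_neq0[z];
  rewrite mulf_eq0 negb_or => /andP[xz zy].
  by rewrite (entry_neq0 xz); exact: bl zy.
exact: bl xz.
Qed.

Definition ideal_of (l : L) : set A := [set a | forall e : R, 0 < e ->
  exists n (b : D n), below b l /\ rnorm (a - phi b) <= e].

Lemma ideal_of_from l a e : ideal_of l a -> 0 < e ->
  exists N, forall m, (N <= m)%N ->
    exists2 b : D m, below b l & rnorm (a - phi b) <= e.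
Proof.
move=> al /al[N [b [bl ab]]]; exists N => m /subnK <-.
exists (sh (m - N) b); first exact/below_shift.
by rewrite phi_shift.
Qed.

Lemma ideal_of_in l n (b : D n) : below b l -> ideal_of l (phi b).
Proof.
by move=> bl e e0; exists n, b; split=> //; rewrite subrr rnorm0 ltW.
Qed.

Lemma ideal_of_closed_ideal l : is_closed_ideal (ideal_of l).
Proof.
split.
- apply/closed_rnormP => a al e e0; have e2 : 0 < e / 2 by rewrite divr_gt0.
  have [b /(_ _ e2)[n [b' [b'l bb']]] ab] := al _ e2.
  exists n, b'; split=> //; rewrite (le_trans (rnorm_dist3 _ b _)) //.
  by rewrite [e]splitr lerD.
- by rewrite -(star_hom0 (phi_hom 0)); apply: ideal_of_in; exact: below0.
- move=> k a b al bl e e0; have k1 : 0 < cabs k + 1 by rewrite ltr_wpDl ?cabs_ge0.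
  have [N NP] := ideal_of_from al (divr_gt0 e0 k1 : 0 < e / (cabs k + 1)).
  have [M MP] := ideal_of_from bl (divr_gt0 e0 k1 : 0 < e / (cabs k + 1)).
  have [a' a'l aa'] := NP (maxn N M) (leq_maxl _ _).
  have [b' b'l bb'] := MP (maxn N M) (leq_maxr _ _).
  exists (maxn N M), (k *: a' + b'); split; first exact: belowP.
  rewrite (star_homD (phi_hom _)) phiZ opprD addrACA -scalerBr (le_trans (rnormD _ _)) // rnormZ.
  have -> : e = cabs k * (e / (cabs k + 1)) + e / (cabs k + 1).
    by rewrite -[Z in _ = _ + Z]mul1r -mulrDl mulrC divfK // gt_eqF.
  by rewrite lerD // ler_wpM2l ?cabs_ge0.
- move=> a b bl; split=> e e0.
    have [t t0 tP] := rnorm_cmul_approx a b e0.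
    have [N NP] := dense_from a t0; have [M MP] := ideal_of_from bl t0.
    have [a' aa'] := NP (maxn N M) (leq_maxl _ _).
    have [b' b'l bb'] := MP (maxn N M) (leq_maxr _ _).
    exists (maxn N M), (cmul a' b'); split; first exact: (belowM _ b'l).1.
    by rewrite phiM tP.
  have [t t0 tP] := rnorm_cmul_approx b a e0.
  have [N NP] := dense_from a t0; have [M MP] := ideal_of_from bl t0.
  have [a' aa'] := NP (maxn N M) (leq_maxl _ _).
  have [b' b'l bb'] := MP (maxn N M) (leq_maxr _ _).
  exists (maxn N M), (cmul b' a'); split; first exact: (belowM _ b'l).2.
  by rewrite phiM tP.
Qed.

Lemma shift_01 n k (a : D n) :
  (forall x y, entry a x y = 0 \/ entry a x y = 1) ->
  forall x y, entry (sh k a : D (k + n)%N) x y = 0 \/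
              entry (sh k a : D (k + n)%N) x y = 1.
Proof.
move=> a01; elim: k => [//|k IHk] x' y'.
have [->|] := eqVneq (entry (sh k.+1 a : D (k.+1 + n)%N) x' y') 0; first by left.
by move=> /entry_embed_neq0[x [y [_ _ /= ->]]]; exact: IHk.
Qed.

(** An element within 1/2 of [a] is nonzero at every entry where [a] is 1. This survives the passage
    to the level of the approximation, as [shift] only copies entries or inserts zeros. *)
Lemma below_of_ideal_of l n (a : D n) :
  (forall x y, entry a x y = 0 \/ entry a x y = 1) ->
  ideal_of l (phi a) -> below a l.
Proof.
move=> a01 al; have h0 : 0 < 2^-1 :> R by rewrite invr_gt0.
have [N NP] := ideal_of_from al h0.
have [b bl ab] := NP (N + n)%N (leq_addr _ _).
apply/(below_shift N) => x y axy; apply: (bl x y).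
have [a0|a1] := @shift_01 n N a a01 x y; first by rewrite a0 eqxx in axy.
apply/eqP => b0; move: ab; rewrite -(phi_shift N a) -phiB phi_opnorm.
move=> /(le_trans (entry_le_opnorm _ x y)).
by rewrite entryD entryN b0 a1 subr0 cabs1 leNgt invf_lt1 // ltr1n.
Qed.

(** * Comparison of the ideals of labels *)

Section OrderIso.
Hypothesis c_onto : forall a, compact_element a -> exists n, c n = a.

(** For the converse it suffices to treat compact elements [c n <= l]. The vertex added at step [n]
    has the label [c n]; matrix units at its successors lie in [ideal_of l], hence in [ideal_of l'],
    so their labels and the join [c n] of these are below [l']. *)
Lemma ideal_of_le l l' : (l <= l')%O <-> ideal_of l `<=` ideal_of l'.
Proof.
split=> [ll' a al e /al[n [b [bl ab]]]|ll'].
  by exists n, b; split=> // x y /bl /le_trans; exact.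
apply: (compact_lsup_le hL) => a /c_onto[n <-] al.
apply: (@le_of_next _ _ _ _ _ (@cc n) None) => w nw.
have [x xw] := @str_surj _ _ hL (St n.+1) w.
pose u : D n.+1 := munit R (@str _ _ hL (St n.+1)) x x.
have ul : below u l.
  move=> y z; rewrite entry_munit //; have [-> _|] := eqVneq y x; last by rewrite eqxx.
  by rewrite xw (le_trans _ al) //; exact: (next_le nw).
have u01 y z : entry u y z = 0 \/ entry u y z = 1.
  by rewrite entry_munit //; case: andP; [right|left].
have /(_ x x) := below_of_ideal_of u01 (ll' _ (ideal_of_in ul)).
by rewrite entry_munit // !eqxx oner_eq0 xw; exact.
Qed.

End OrderIso.

(** * Every closed ideal comes from a label *)

Section OntoIdeals.
Variable I : set A.
Hypothesis Iid : is_closed_ideal I.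

Local Notation mu := (munit R r).

Definition unit_in n (x : X n) : Prop := I (phi (mu x x : D n)).

(** The diagonal units of one block are multiples of each other: [e_yy = e_yx e_xx e_xy]. *)
Lemma unit_in_block n (x y : X n) : r x = r y -> unit_in x -> unit_in y.
Proof.
move=> rxy xI; rewrite /unit_in -(munit_mul R (esym rxy) rxy) phiM.
rewrite -(munit_mul R (erefl (r x)) rxy) phiM.
by apply: (closed_idealMl Iid); exact: (closed_idealMr Iid).
Qed.

Lemma unit_in_child n (x : X n) (x' : X n.+1) : parent x' = Some x ->
  unit_in x -> unit_in x'.
Proof.
move=> px xI; rewrite /unit_in.
have -> : (mu x' x' : D n.+1) = cmul (mu x' x') (cmul (f (mu x x)) (mu x' x')).
  rewrite munit_mul_munit // (entry_embed _ px px) // entry_munit // !eqxx.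
  by rewrite scale1r.
rewrite !phiM; apply: (closed_idealMl Iid); apply: (closed_idealMr Iid).
by rewrite phi_embed.
Qed.

Lemma in_of_entries n (a : D n) : (forall x y, entry a x y != 0 -> unit_in x) ->
  I (phi a).
Proof.
move=> aI; rewrite [a]sum_munit phi_sum; apply: (closed_ideal_sum Iid) => x.
rewrite phi_sum; apply: (closed_ideal_sum Iid) => y; rewrite phiZ.
have [->|axy] := eqVneq (entry a x y) 0.
  by rewrite scale0r; exact: closed_ideal0 Iid.
apply: (closed_idealZ Iid); rewrite -(munit_mul R (erefl (r x)) (entry_neq0 axy)).
by rewrite phiM; apply: (closed_idealMr Iid); exact: aI axy.
Qed.

Definition vertices_in n : {set V n} :=
  [set v | `[< exists2 x : X n, r x = v & unit_in x >]]%SET.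

Lemma vertices_inP n (x : X n) : r x \in vertices_in n <-> unit_in x.
Proof.
rewrite inE; split=> [/asboolP[y ryx yI]|xI]; first exact: unit_in_block yI.
by apply/asboolP; exists x.
Qed.

Definition stage_sup n : L := tsup hL (@stl _ _ hL (St n)) (vertices_in n).

Lemma stage_sup_mono m n : (m <= n)%N -> (stage_sup m <= stage_sup n)%O.
Proof.
move=> /subnK <-; elim: (n - m)%N => [|k IHk]; first exact: lexx.
apply: le_trans IHk _; apply/lsup_leP => _ [v /= vI <-].
have [x xv] := @str_surj _ _ hL (St (k + m)%N) v.
apply: (@le_of_next _ _ _ _ _ (@cc (k + m)%N) (Some v)) => w vw.
rewrite -xv in vw vI; have [x' px x'w] := next_path_exists vw.
apply: le_lsup; exists w => //=; rewrite -x'w; apply/(@vertices_inP (k + m).+1).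
by apply: unit_in_child px _; exact/vertices_inP.
Qed.

Definition ideal_sup : L := lsup hL (range stage_sup).

(** Compactness leaves finitely many of the [stage_sup n], and these increase with [n]. *)
Lemma label_le_stage_sup a : compact_element a -> (a <= ideal_sup)%O ->
  exists n, (a <= stage_sup n)%O.
Proof.
move=> ac /(compact_le_fsup ac)[s [sT as_]].
suff [n nP] : exists n, (fsup hL s <= stage_sup n)%O.
  by exists n; exact: le_trans as_ nP.
elim: s sT {as_} => [|b s IHs] sT; first by exists 0%N; exact: lbot_le.
have [n nP] := IHs (fun x xs => sT x (mem_behead (s := b :: s) xs)).
have [m _ mb] := sT b (mem_head _ _).
exists (maxn m n); rewrite /= leUx -mb stage_sup_mono ?leq_maxl //=.
by rewrite (le_trans nP) // stage_sup_mono // leq_maxr.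
Qed.

(** One level later, [next_prime] provides each successor of a vertex occurring in [a] with a
    predecessor whose block lies in [I]; hence the block of that successor lies in [I]. *)
Lemma below_stage_sup_in n (a : D n) : below a (stage_sup n) -> I (phi a).
Proof.
move=> al; rewrite -phi_embed; apply: in_of_entries => x' y' /[dup] fa0.
move=> /entry_embed_neq0[x [y [px py faE]]]; rewrite faE in fa0.
have [u uI uw] := next_prime (parent_edge px) (al _ _ fa0).
have [x1 x1u] := @str_surj _ _ hL (St n) u; rewrite -x1u in uI uw.
have [x1' px1 x1w] := next_path_exists uw.
apply: (@unit_in_block n.+1 x1' x' x1w).
by apply: unit_in_child px1 _; exact/vertices_inP.
Qed.

Lemma ideal_of_sup_sub : ideal_of ideal_sup `<=` I.
Proof.
move=> a al; apply: (closed_idealP Iid) => e /al[n [b [bl ab]]].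
exists (phi b) => //.
(* Level [n] has finitely many labels, all compact, so one [N] serves them all. *)
have [N _ NP] : \forall N \near \oo, forall x : X n,
    (label (r x) <= ideal_sup)%O -> (label (r x) <= stage_sup N)%O.
  apply: filter_forall => x.
  have [xl|] := boolP (label (r x) <= ideal_sup)%O; last by exists 0%N.
  have [M MP] := label_le_stage_sup (@stl_compact _ _ hL (St n) (r x)) xl.
  by exists M => // N MN _; apply: le_trans MP _; exact: stage_sup_mono.
rewrite -(phi_shift N b); apply: below_stage_sup_in; apply/below_shift => x y bxy.
by apply: (NP (N + n)%N (leq_addr _ _)); exact: bl bxy.
Qed.

Definition outside n (a : D n) : D n :=
  of_entries r (fun x y => if `[< unit_in x >] then 0 else entry a x y).

Lemma entry_outside n (a : D n) x y :
  entry (outside a) x y = if `[< unit_in x >] then 0 else entry a x y.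
Proof.
rewrite entry_of_entries; case: eqP => // /eqP rxy.
by case: ifP => // _; rewrite entry_off_block.
Qed.

(** Otherwise some vector [u] is stretched by more than the distance from [d0] to [a]. Compressing
    [a] along [u] gives an element of [I] at distance less than 1 from a matrix unit that is not in
    [I], against [closed_ideal_near_projection]. *)
Lemma opnorm_outside_le n (d0 : D n) (a : A) : I a ->
  opnorm (outside d0) <= rnorm (phi d0 - a).
Proof.
move=> aI; rewrite leNgt; apply/negP => lt_d.
have [u [ub u1 lt_u]] : exists u, [/\ in_one_block r u, l2norm u <= 1 &
    rnorm (phi d0 - a) < l2norm (act (outside d0) u)].
  apply: contrapT => no; move: lt_d; apply/negP; rewrite -leNgt.
  apply: opnorm_le => u ub u1; rewrite leNgt; apply/negP => lt_u.
  by apply: no; exists u.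
have [x0 vx0] : exists x0, act (outside d0) u x0 != 0.
  apply: contrapT => no; move: lt_u; apply/negP; rewrite -leNgt.
  rewrite (_ : l2norm _ = 0) ?rnorm_ge0 // -[RHS](l2norm0 R (X n)).
  congr l2norm; apply/funext => x; apply/eqP; apply: contrapT => /negP v0.
  by apply: no; exists x.
have x0I : ~ unit_in x0.
  move=> x0I; move/eqP: vx0; apply; rewrite /act big1 // => y _.
  by rewrite entry_outside asboolT ?mul0r.
(* The vector [u] is supported in the block of [x0], which is not in [I]; there [outside d0] and
   [d0] agree. *)
have vE : act (outside d0) u = act d0 u.
  have [y0] := sum_neq0 vx0; rewrite mulf_eq0 negb_or => /andP[/entry_neq0 ry0 uy0].
  apply/funext => x; apply: eq_bigr => y _; rewrite entry_outside.
  case: asboolP => // xI; rewrite mul0r.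
  have [uy|uy] := eqVneq (u y) 0; first by rewrite uy mulr0.
  rewrite entry_off_block ?mul0r //; apply/eqP => rxy; apply: x0I.
  apply: unit_in_block xI; rewrite rxy ry0; exact: ub.
rewrite vE in lt_u vx0.
have [W [U [W1 U1 WU]]] := compress_to_munit ub u1 vx0.
set v := l2norm (act d0 u) in lt_u W1 WU.
have v_gt0 : 0 < v by rewrite (le_lt_trans _ lt_u) // rnorm_ge0.
have v2_gt0 : 0 < v ^+ 2 by rewrite exprn_gt0.
pose q : A := phi (mu x0 x0 : D n).
(* With [d0] in place of [a] this would be exactly [q]. As [W] has norm at most [v] and [U] at most
   1, the distance from [q] to [b] is at most [rnorm (phi d0 - a) / v], which is less than 1. *)
pose b : A := ((v ^+ 2)^-1)%:C%C *: cmul (phi W) (cmul a (phi U)).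
apply: x0I; apply: (@closed_ideal_near_projection _ _ _ Iid q b).
- by rewrite /q -(star_homS (phi_hom n)) munit_star.
- by rewrite /q -phiM munit_mul.
- by apply: (closed_idealZ Iid); apply: (closed_idealMl Iid); exact: (closed_idealMr Iid).
have -> : q - b = ((v ^+ 2)^-1)%:C%C *: cmul (phi W) (cmul (phi d0 - a) (phi U)).
  rewrite cmulBl cmulBr scalerBr -!phiM WU phiZ scalerA -real_complexM.
  by rewrite mulVf ?gt_eqF // scale1r.
rewrite rnormZ cabsR ?invr_ge0 ?ltW // mulrC ltr_pdivrMr // mul1r expr2.
rewrite (le_lt_trans (rnorm_cmul _ _)) //.
apply: (@le_lt_trans _ _ (v * rnorm (phi d0 - a))); last by rewrite ltr_pM2l.
rewrite ler_pM ?rnorm_ge0 //; first by rewrite phi_opnorm.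
by rewrite (le_trans (rnorm_cmul _ _)) // ler_piMr ?rnorm_ge0 // phi_opnorm.
Qed.

Lemma sub_ideal_of_sup : I `<=` ideal_of ideal_sup.
Proof.
move=> a aI e e0; have e2 : 0 < e / 2 by rewrite divr_gt0.
have [n nP] := dense_from a e2; have [d0 ad] := nP n (leqnn n).
(* What remains of [d0] lives in blocks contained in [I], and the part removed has norm at most the
   distance from [d0] to [a]. *)
exists n, (d0 - outside d0); split=> [x y|].
  rewrite entryD entryN entry_outside; case: asboolP => [xI _|]; last by rewrite subrr eqxx.
  apply: (@le_trans _ _ (stage_sup n)); last by apply: le_lsup; exists n.
  by apply: le_lsup; exists (r x) => //=; exact/vertices_inP.
rewrite phiB opprB addrCA addrC [e]splitr (le_trans (rnormD _ _)) // lerD //.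
by rewrite phi_opnorm (le_trans (opnorm_outside_le _ aI)) // rnorm_distC.
Qed.

Lemma ideal_of_ideal_sup : ideal_of ideal_sup = I.
Proof.
by apply/seteqP; split; [exact: ideal_of_sup_sub|exact: sub_ideal_of_sup].
Qed.

End OntoIdeals.

Lemma isomorphic_of_dense : (forall a, compact_element a -> exists n, c n = a) ->
  isomorphic_to_closed_ideals L A.
Proof.
move=> c_onto.
pose F l : closed_ideal A := exist _ (ideal_of l) (ideal_of_closed_ideal l).
pose G (J : closed_ideal A) : L := ideal_sup (sval J).
have FG : cancel G F.
  move=> [J JI]; rewrite /F /G /=; apply: eq_exist => /=.
  exact: ideal_of_ideal_sup.
exists F => [|l l']; last exact: ideal_of_le.
exists G => // l; apply/eqP; rewrite eq_le.
have /= FGl : ideal_of (G (F l)) = ideal_of l := congr1 sval (FG (F l)).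
by apply/andP; split; apply/(ideal_of_le c_onto); rewrite FGl.
Qed.

(** * The unital case *)

Section Unital.
Hypothesis c_top : forall x : L, (x <= c 0)%O.

(** At level 1 the successors of the first added vertex have the join [c 0], which is the greatest
    element; passing to successors preserves joins. *)
Lemma labels_cover n x : (x <= tsup hL (@stl _ _ hL (St n.+1)) finset.setT)%O.
Proof.
apply: le_trans (c_top x) _; elim: n => [|n IHn].
  apply: (@le_of_next _ _ _ _ _ (@cc 0) None) => w _.
  by apply: le_lsup; exists w => //=; rewrite inE.
apply: le_trans IHn _; apply/lsup_leP => _ [v _ <-].
apply: (@le_of_next _ _ _ _ _ (@cc n.+1) (Some v)) => w _.
by apply: le_lsup; exists w => //=; rewrite inE.
Qed.

(** Primality, applied to [None] and the set of all old vertices, yields an old predecessor. This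
    needs [labels_cover] one level below, hence it starts at level 2. *)
Lemma parent_neq_none n (x' : X n.+2) : parent x' <> None.
Proof.
move=> /parent_none[nw noV].
have [u _ uw] := next_prime nw (labels_cover n _).
by have := noV u; rewrite uw.
Qed.

Definition level_one n : D n := identity_blocks R r.

Lemma embed_level_one n : f (level_one n.+1) = level_one n.+2.
Proof.
apply: entry_inj => x' y'; rewrite entry_identity.
have [rxy|rxy] := eqVneq (r x') (r y'); last first.
  rewrite entry_off_block //; case: eqP => // xy.
  by rewrite xy eqxx in rxy.
case px : (parent x') => [x|]; last by case: (parent_neq_none px).
case py : (parent y') => [y|]; last by case: (parent_neq_none py).
rewrite (@entry_embed n.+1 _ _ _ _ _ px py) // entry_identity; congr (nat_of_bool _)%:R.
apply/eqP/eqP => [xy|xy]; last by move: px; rewrite xy py => -[].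
by apply: parent_inj => //; rewrite px // py xy.
Qed.

Lemma unital_of_dense : unital A.
Proof.
(* Level 0 is the zero algebra; from level 1 on, the connecting maps preserve the identities. *)
exists (phi (level_one 1)).
have phi_level_one k : phi (level_one k.+1) = phi (level_one 1).
  by elim: k => // k <-; rewrite -embed_level_one phi_embed.
move=> a; set u := phi (level_one 1).
have near_a e : 0 < e -> exists2 b : A, cmul u b = b /\ cmul b u = b &
    rnorm (a - b) <= e.
  move=> /(dense_from a)[N /(_ _ (leqnSn N))[b ab]]; exists (phi b) => //.
  by rewrite /u -(phi_level_one N) -!phiM; have [-> ->] := identity_blocks_mul b.
have K0 : 0 < rnorm u + 1 by rewrite ltr_wpDl ?rnorm_ge0.
split; apply: rnorm_eq => e e0.
  have [b [ub _] ab] := near_a _ (divr_gt0 e0 K0).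
  have -> : cmul u a - a = cmul u (a - b) - (a - b).
    by rewrite cmulBr ub opprB addrA subrK.
  rewrite (le_trans (rnormB _ _)) //.
  rewrite (le_trans (lerD (rnorm_cmul _ _) (lexx _))) //.
  rewrite -[Z in _ + Z]mul1r -mulrDl mulrC -ler_pdivlMr //.
have [b [_ bu] ab] := near_a _ (divr_gt0 e0 K0).
have -> : cmul a u - a = cmul (a - b) u - (a - b).
  by rewrite cmulBl bu opprB addrA subrK.
rewrite (le_trans (rnormB _ _)) //.
rewrite (le_trans (lerD (rnorm_cmul _ _) (lexx _))) //.
rewrite -[Z in _ + Z]mulr1 -mulrDr -ler_pdivlMr //.
Qed.

End Unital.

End IdealLattice.

(** * The AF algebra of the diagram *)

Section TowerAlgebra.
Variables (R : realType) (d : Order.disp_t) (L : distrLatticeType d).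
Hypothesis hL : algebraic_lattice L.
Variable c : nat -> L.
Hypothesis cc : forall n, compact_element (c n).
Local Notation sys := (tower_system R hL cc).

Lemma tower_AF : is_AF (dlim sys).
Proof.
exists (sysD sys), (@sysf R sys), (dlim sys), (@dlim_in R sys); split.
- by move=> n; exact: blocks_finite_dimensional.
- exact: sys_hom.
- exact: dlim_direct_limit.
- by exists idfun; [exact: star_hom_id|exists idfun].
Qed.

Lemma tower_ideals : (forall a, compact_element a -> exists n, c n = a) ->
  isomorphic_to_closed_ideals L (dlim sys).
Proof.
apply: (@isomorphic_of_dense _ _ _ hL c cc (dlim sys) (@dlim_in R sys)).
- exact: (@dlim_in_hom R sys).
- exact: (@dlim_in_iso R sys).
- exact: (@dlim_in_compat R sys).
- exact: (@dlim_in_dense R sys).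
Qed.

Lemma tower_unital : (forall x : L, (x <= c 0)%O) -> unital (dlim sys).
Proof.
apply: (@unital_of_dense _ _ _ hL c cc (dlim sys) (@dlim_in R sys)).
- exact: (@dlim_in_hom R sys).
- exact: (@dlim_in_compat R sys).
- exact: (@dlim_in_dense R sys).
Qed.

End TowerAlgebra.

Theorem theorem9p1 (R : realType) (d : Order.disp_t) (L : distrLatticeType d)
    (hL : algebraic_lattice L)
    (hc : countable [set c : L | compact_element c]%classic) :
  (exists A : cstarAlgType R, is_AF A /\ isomorphic_to_closed_ideals L A) /\
  ((exists2 top : L, (forall x : L, (x <= top)%O) & compact_element top) ->
   exists A : cstarAlgType R,
     [/\ is_AF A, unital A & isomorphic_to_closed_ideals L A]).
Proof.
have [c cc c_onto] : exists2 c : nat -> L, (forall n, compact_element (c n)) &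
    forall a, compact_element a -> exists n, c n = a.
  have /countable_injP[g g_inj] := hc.
  have ex n : exists a, compact_element a /\
      forall b, compact_element b -> g b = n -> a = b.
    have [[a [ac an]]|no] := pselect (exists a, compact_element a /\ g a = n).
      exists a; split=> // b bc bn.
      by apply: g_inj; rewrite ?inE // an bn.
    (* Numbers that [g] does not attain on compact elements are assigned the bottom, which is
       compact. *)
    exists (lbot hL); split; first exact: compact_lbot.
    by move=> b bc bn; case: no; exists b.
  have [c cP] := choice ex; exists c => [n|a ac]; first by case: (cP n).
  by exists (g a); apply: (cP (g a)).2.
split.
  exists (dlim (tower_system R hL cc)); split; first exact: tower_AF.
  exact: tower_ideals.
move=> [top top_ge topc].
(* The greatest element is placed first, as the unital case requires; the old enumeration follows,
   shifted by one. *)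
pose c' n := if n is n'.+1 then c n' else top.
have cc' n : compact_element (c' n) by case: n.
exists (dlim (tower_system R hL cc')); split; first exact: tower_AF.
  exact: tower_unital.
by apply: tower_ideals => a /c_onto[n na]; exists n.+1.
Qed.
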